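(* Consider the consistency-constrained multi-coalition game and the distributed algorithm described in the context. Suppose that (A1), (A2) and (A3) hold, and that the step size $\alpha>0$ satisfies $$\alpha\le\min\Big\{\frac{l}{2N\sigma},\ \frac{\gamma_1}{8\sigma},\ \frac{\gamma_2}{8\sigma},\ 1\Big\},$$ where $\gamma_1=4\beta_{\bar x\psi}$, $\gamma_2=4(\beta_{\bar x\xi}+\beta_{\psi\xi}\gamma_1)$, $\gamma_3=4(\beta_{\psi x}\gamma_1+\beta_{\xi x}\gamma_2)$, and $\sigma=\max_i b_{1i}+\gamma_2\max_i b_{2i}+\gamma_3\max_i b_{3i}$, with the constants $\beta_{\psi\xi},\beta_{\psi x},\beta_{\xi x},\beta_{\bar x\psi},\beta_{\bar x\xi},b_{1i},b_{2i},b_{3i}$ defined in the context. Then, for every choice of the initial values $x_{ij}(0)\in\mathbb{R}$ and $\bm{\xi}_{ij}(0)\in\mathbb{R}^{n_{\mathrm{sum}}}$, the collective state converges to the Nash equilibrium: $\lim_{k\to\infty}\bm{x}(k)=\bm{x}^*$.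
   Context: Game. There are $N$ coalitions; coalition $i$ ($i=1,\dots,N$) consists of $n_i\ge1$ agents labeled $i1,\dots,in_i$; $\mathcal V_i=\{i1,\dots,in_i\}$, $\mathcal V=\bigcup_i\mathcal V_i$, $n_{\mathrm{sum}}=\sum_i n_i$. Agents are ordered lexicographically ($11,\dots,1n_1,21,\dots,Nn_N$). Agent $ij$ has a state $x_{ij}\in\mathbb{R}$; $\bm{x}_i=(x_{i1},\dots,x_{in_i})^T$, $\bm{x}=(\bm{x}_1^T,\dots,\bm{x}_N^T)^T\in\mathbb{R}^{n_{\mathrm{sum}}}$. Each agent has a cost $f_{ij}:\mathbb{R}^{n_{\mathrm{sum}}}\to\mathbb{R}$; coalition cost $f_i=\sum_{j=1}^{n_i}f_{ij}$. Coalition $i$ minimizes $f_i$ over $\bm{x}_i$ subject to $\bm{x}_i\in\Omega_i=\{\theta\mathbf 1_{n_i}:\theta\in\mathbb{R}\}$. A Nash equilibrium (NE) is $\bm{x}^*=(\bm{x}_1^{*T},\dots,\bm{x}_N^{*T})^T$ with every $\bm{x}_i^*\in\Omega_i$ and $f_i(\bm{x}_i^*,\bm{x}_{-i}^* )\le f_i(\bm{x}_i,\bm{x}_{-i}^* )$ for all $\bm{x}_i\in\Omega_i$ and all $i$. For $\bm y\in\mathbb{R}^N$ let $g_i(\bm y)=f_i((y_1\mathbf 1_{n_1}^T,\dots,y_N\mathbf 1_{n_N}^T)^T)$ and $\mathcal Q(\bm y)=(\partial g_1/\partial y_1(\bm y),\dots,\partial g_N/\partial y_N(\bm y))^T$.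 Under (A2)–(A3) the game $\min_{y_i}g_i(\bm y)$, $i=1,\dots,N$, has a unique NE $\bm y^*$, and $\bm x^*=(y_1^*\mathbf 1_{n_1}^T,\dots,y_N^*\mathbf 1_{n_N}^T)^T$ is the NE of the coalition game. Graph. Directed graph $\mathcal G=(\mathcal V,\mathcal E)$; $(pq,ij)\in\mathcal E$ means agent $ij$ receives information from $pq$. Adjacency: $a_{ij}^{pq}=1$ if $(pq,ij)\in\mathcal E$ and $pq\neq ij$, otherwise $0$. In-degree $d_{ij}=\sum_{pq}a_{ij}^{pq}$. Laplacian $L\in\mathbb{R}^{n_{\mathrm{sum}}\times n_{\mathrm{sum}}}$ (rows/columns in lexicographic order) with diagonal entries $d_{ij}$ and off-diagonal entries $-a_{ij}^{pq}$. $\mathcal G_i$ is the subgraph induced on $\mathcal V_i$. $\mathcal N_{ij}^{\mathrm{in}}=\{pq:(pq,ij)\in\mathcal E\}$, $\mathcal N_{ij}^{i\text{-in}}=\{im\in\mathcal V_i:(im,ij)\in\mathcal E\}$, $\mathcal N_{ij}^{i\text{-out}}=\{im\in\mathcal V_i:(ij,im)\in\mathcal E\}$. Assumptions. (A1) $\mathcal G$ is strongly connected and every $\mathcal G_i$ is strongly connected. (A2) Each $f_{ij}$ is convex and $C^2$, and $\nabla f_{ij}$ is Lipschitz with constant $l_{ij}$. (A3) There is $l>0$ with $(\bm a-\bm b)^T(\mathcal Q(\bm a)-\mathcal Q(\bm b))\ge l\|\bm a-\bm b\|^2$ for all $\bm a,\bm b\in\mathbb{R}^N$. Algorithm. Each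 agent $ij$ chooses weights $r_{ij}^{im}>0$ for $im\in\mathcal N_{ij}^{i\text{-in}}\cup\{ij\}$ with $\sum_{im\in\mathcal N_{ij}^{i\text{-in}}\cup\{ij\}}r_{ij}^{im}=1$, and $c_{im}^{ij}>0$ for $im\in\mathcal N_{ij}^{i\text{-out}}\cup\{ij\}$ with $\sum_{im\in\mathcal N_{ij}^{i\text{-out}}\cup\{ij\}}c_{im}^{ij}=1$; all other $r_{ij}^{im},c_{ij}^{im}$ within coalition $i$ are $0$. Let $R_i=[r_{ij}^{im}]$, $C_i=[c_{ij}^{im}]\in\mathbb{R}^{n_i\times n_i}$ ($j$ = row, $m$ = column); $R_i$ is row stochastic, $C_i$ column stochastic. Agent $ij$ keeps $x_{ij}(k)$, $\psi_{ij}^{il}(k)\in\mathbb{R}$ ($l=1,\dots,n_i$) and $\bm\xi_{ij}(k)=(\xi_{ij}^{pq}(k))_{pq\in\mathcal V}\in\mathbb{R}^{n_{\mathrm{sum}}}$ (lexicographic order). Initialization: $x_{ij}(0),\bm\xi_{ij}(0)$ arbitrary, $\psi_{ij}^{il}(0)=\frac{\partial f_{ij}}{\partial x_{il}}(\bm\xi_{ij}(0))$. For $k\ge0$: $x_{ij}(k+1)=\sum_{m=1}^{n_i}r_{ij}^{im}x_{im}(k)-\frac{\alpha}{n_i}\sum_{m=1}^{n_i}\psi_{ij}^{im}(k)$; $\xi_{ij}^{pq}(k+1)=\xi_{ij}^{pq}(k)-\frac{1}{d_{ij}+a_{ij}^{pq}}\Big(\sum_{lm\in\mathcal N_{ij}^{\mathrm{in}}}(\xi_{ij}^{pq}(k)-\xi_{lm}^{pq}(k))+a_{ij}^{pq}(\xi_{ij}^{pq}(k)-x_{pq}(k))\Big)$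 for all $pq\in\mathcal V$; $\psi_{ij}^{il}(k+1)=\sum_{m=1}^{n_i}c_{ij}^{im}\psi_{im}^{il}(k)+\frac{\partial f_{ij}}{\partial x_{il}}(\bm\xi_{ij}(k+1))-\frac{\partial f_{ij}}{\partial x_{il}}(\bm\xi_{ij}(k))$, $l=1,\dots,n_i$. Auxiliary quantities (all under (A1)). $u_i$: the vector with $u_i^TR_i=u_i^T$, $u_i^T\mathbf 1_{n_i}=n_i$; $v_i$: the vector with $C_iv_i=v_i$, $\mathbf 1_{n_i}^Tv_i=n_i$. $\bar C_i=C_i-\frac{v_i\mathbf 1_{n_i}^T}{n_i}$, $\bar I_{v_i}=I_{n_i}-\frac{v_i\mathbf 1_{n_i}^T}{n_i}$, $\bar R_i=R_i-\frac{\mathbf 1_{n_i}u_i^T}{n_i}$, $\bar I_{u_i}=I_{n_i}-\frac{\mathbf 1_{n_i}u_i^T}{n_i}$. $\Gamma$ and $A_d$ are the $n_{\mathrm{sum}}^2\times n_{\mathrm{sum}}^2$ diagonal matrices whose diagonal entries, indexed by pairs $(ij,pq)$ with $ij$ the outer and $pq$ the inner lexicographic index, are $\frac{1}{d_{ij}+a_{ij}^{pq}}$ and $a_{ij}^{pq}$ respectively. $H=\Gamma(L\otimes I_{n_{\mathrm{sum}}}+A_d)$, $\mathcal M=I_{n_{\mathrm{sum}}^2}-H$. $\bar C_i,\bar R_i,\mathcal M$ are Schur; $W_{c_i},W_{R_i},W_{\mathcal M}$ are the symmetric positive definite solutions of $\bar C_i^TW_{c_i}\bar C_i-W_{c_i}=-I_{n_i}$,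 $\bar R_i^TW_{R_i}\bar R_i-W_{R_i}=-I_{n_i}$, $\mathcal M^TW_{\mathcal M}\mathcal M-W_{\mathcal M}=-I_{n_{\mathrm{sum}}^2}$. Matrix norms are spectral norms. Constants: $\beta_{\psi\xi}=2\max_{i,j}\{(2\|\bar C_i^TW_{c_i}\bar I_{v_i}\|^2+\|\bar I_{v_i}^TW_{c_i}\bar I_{v_i}\|)l_{ij}^2\}\,\|H\|^2$, $\beta_{\psi x}=n_{\mathrm{sum}}\beta_{\psi\xi}$, $\beta_{\xi x}=n_{\mathrm{sum}}(4\|\mathcal M^TW_{\mathcal M}\|^2+2\|W_{\mathcal M}\|)\|H\|^2$, $\beta_{\bar x\psi}=\frac2l\max_i\frac{n_i^3\|u_i\|^2}{(u_i^Tv_i)^2}$, $\beta_{\bar x\xi}=\frac2l\max_i\{n_i\sum_{j=1}^{n_i}l_{ij}^2\}$, $b_{0i}=n_i+(\frac1{n_i}+\max_k n_k)\|v_i\|^2\sum_{j=1}^{n_i}l_{ij}^2$, $b_{1i}=\frac{\|u_i\|^2}{n_iu_i^Tv_i}b_{0i}$, $b_{2i}=n_{\mathrm{sum}}(4\|\mathcal M^TW_{\mathcal M}\|^2+2\|W_{\mathcal M}\|)\|\frac{\mathbf 1_{n_i}u_i^T}{n_i^2}\|^2b_{0i}$, $b_{3i}=\frac1{n_i^2}(2\|\bar R_i^TW_{R_i}\bar I_{u_i}\|^2+\|\bar I_{u_i}^TW_{R_i}\bar I_{u_i}\|)b_{0i}$. *)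

(* Defs.v *)
From HB Require Import structures.
From mathcomp Require Import all_boot all_order all_algebra.
From mathcomp Require Import all_classical all_reals all_analysis.
Set Implicit Arguments. Unset Strict Implicit. Unset Printing Implicit Defensive.
Import Order.TTheory GRing.Theory Num.Theory.
Import numFieldNormedType.Exports.
Local Open Scope ring_scope.
Local Open Scope classical_set_scope.

Definition vnorm (R : realType) n (v : 'cV[R]_n) : R := Num.sqrt (\sum_k v k 0 ^+ 2).
Definition rnorm (R : realType) n (v : 'rV[R]_n) : R := Num.sqrt (\sum_k v 0 k ^+ 2).

Definition opnorm (R : realType) m n (A : 'M[R]_(m, n)) : R :=
  sup [set r | exists v : 'cV[R]_n, vnorm v <= 1 /\ r = vnorm (A *m v)].

Definition sym_pd (R : realType) n (W : 'M[R]_n) : Prop :=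
  W^T = W /\ forall v : 'cV[R]_n, v != 0 -> 0 < (v^T *m W *m v) 0 0.

Definition partial (R : realType) n (f : 'rV[R]_n -> R) (k : 'I_n) (a : 'rV[R]_n) : R :=
  'D_(delta_mx (0 : 'I_1) k) f a.

Definition gradient (R : realType) n (f : 'rV[R]_n -> R) (a : 'rV[R]_n) : 'rV[R]_n :=
  \row_k partial f k a.

Definition convex_fun (R : realType) n (f : 'rV[R]_n -> R) : Prop :=
  forall (a b : 'rV[R]_n) (t : R), 0 <= t <= 1 ->
    f (t *: a + (1 - t) *: b) <= t * f a + (1 - t) * f b.

Definition C2 (R : realType) n (f : 'rV[R]_n -> R) : Prop :=
  (forall a, differentiable f a) /\
  (forall k a, differentiable (partial f k) a) /\
  (forall k m, continuous (partial (partial f k) m)).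

Definition grad_lipschitz (R : realType) n (f : 'rV[R]_n -> R) (lc : R) : Prop :=
  forall a b, rnorm (gradient f a - gradient f b) <= lc * rnorm (a - b).

(* iterated maximum (all quantities maximized below are nonnegative) *)
Definition bmax (R : realType) (I : finType) (F : I -> R) : R :=
  \big[Num.max/0]_(i : I) F i.

(* agent ij = (i, j), i : coalition, j : 'I_(n i); the enumeration of this
   finType is lexicographic, so enum_rank gives the paper's ordering *)
Definition Agent (N : nat) (n : 'I_N -> nat) : finType := {i : 'I_N & 'I_(n i)}.

Definition ag N (n : 'I_N -> nat) (i : 'I_N) (j : 'I_(n i)) : Agent n :=
  existT (fun i => 'I_(n i)) i j.

Definition pos N (n : 'I_N -> nat) (a : Agent n) : 'I_#|{: Agent n}| := enum_rank a.

Section Game.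
Variables (R : realType) (N : nat) (n : 'I_N -> nat).
Local Notation Ag := (Agent n).
Local Notation nsum := #|{: Ag}|.

Definition fcoal (f : forall i, 'I_(n i) -> 'rV[R]_nsum -> R) (i : 'I_N)
  (x : 'rV[R]_nsum) : R := \sum_(j < n i) f i j x.

Definition expand (y : 'rV[R]_N) : 'rV[R]_nsum := \row_s y 0 (tag (enum_val s)).

Definition gfun f (i : 'I_N) (y : 'rV[R]_N) : R := fcoal f i (expand y).

Definition Qmap f (y : 'rV[R]_N) : 'rV[R]_N :=
  \row_i 'D_(delta_mx (0 : 'I_1) i) (gfun f i) y.

Definition setblock (x : 'rV[R]_nsum) (i : 'I_N) (theta : R) : 'rV[R]_nsum :=
  \row_s if tag (enum_val s) == i then theta else x 0 s.

Definition in_Omega (x : 'rV[R]_nsum) : Prop :=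
  forall i (j j' : 'I_(n i)), x 0 (pos (ag j)) = x 0 (pos (ag j')).

Definition is_NE f (xs : 'rV[R]_nsum) : Prop :=
  in_Omega xs /\ forall i (theta : R), fcoal f i xs <= fcoal f i (setblock xs i theta).

Variable E : rel Ag. (* E pq ij : agent ij receives information from pq *)

Definition adj (b a : Ag) : R := (E b a && (b != a))%:R.
Definition deg (a : Ag) : R := \sum_b adj b a.
Definition Lap (a b : Ag) : R := if a == b then deg a else - adj b a.

Definition strongly_connected_A1 : Prop :=
  (forall a b : Ag, connect E a b) /\
  (forall i (j m : 'I_(n i)),
     connect (fun x y : Ag => [&& E x y, tag x == i & tag y == i]) (ag j) (ag m)).

Local Notation D := #|{: (Ag * Ag)%type}|.

(* H = Gamma (L (x) I + A_d), indexed by pairs (ij, pq), ij outer *)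
Definition Hent (s t : Ag * Ag) : R :=
  (deg s.1 + adj s.2 s.1)^-1 *
  (Lap s.1 t.1 * (s.2 == t.2)%:R + (s == t)%:R * adj s.2 s.1).

Definition Hmx : 'M[R]_D := \matrix_(s, t) Hent (enum_val s) (enum_val t).
Definition Mmx : 'M[R]_D := 1%:M - Hmx.

End Game.

Section Coalition.
Variables (R : realType) (m : nat).
Definition ones : 'cV[R]_m := const_mx 1.
Definition Cbar (C : 'M[R]_m) (v : 'cV[R]_m) : 'M[R]_m := C - (m%:R)^-1 *: (v *m ones^T).
Definition Ibar_v (v : 'cV[R]_m) : 'M[R]_m := 1%:M - (m%:R)^-1 *: (v *m ones^T).
Definition Rbar (Rm : 'M[R]_m) (u : 'cV[R]_m) : 'M[R]_m := Rm - (m%:R)^-1 *: (ones *m u^T).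
Definition Ibar_u (u : 'cV[R]_m) : 'M[R]_m := 1%:M - (m%:R)^-1 *: (ones *m u^T).
Definition dotv (u v : 'cV[R]_m) : R := (u^T *m v) 0 0.
End Coalition.

Section Constants.
Variables (R : realType) (N : nat) (n : 'I_N -> nat) (E : rel (Agent n)).
Variables (lA3 : R) (lij : forall i, 'I_(n i) -> R).
Variables (Rw Cw : forall i, 'M[R]_(n i)) (u v : forall i, 'cV[R]_(n i)).
Variables (WR Wc : forall i, 'M[R]_(n i)) (WM : 'M[R]_#|{: (Agent n * Agent n)%type}|).

Local Notation nsumR := (#|{: Agent n}|%:R : R).
Local Notation H := (Hmx R E).
Local Notation M := (Mmx R E).
Local Notation sumL2 i := (\sum_(j < n i) lij j ^+ 2).

Definition beta_psixi : R :=
  2 * bmax (fun i : 'I_N => bmax (fun j : 'I_(n i) =>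
      (2 * opnorm ((Cbar (Cw i) (v i))^T *m Wc i *m Ibar_v (v i)) ^+ 2
       + opnorm ((Ibar_v (v i))^T *m Wc i *m Ibar_v (v i))) * lij j ^+ 2))
  * opnorm H ^+ 2.
Definition beta_psix : R := nsumR * beta_psixi.
Definition beta_xix : R :=
  nsumR * (4 * opnorm (M^T *m WM) ^+ 2 + 2 * opnorm WM) * opnorm H ^+ 2.
Definition beta_xbpsi : R :=
  2 / lA3 * bmax (fun i : 'I_N =>
    (n i)%:R ^+ 3 * vnorm (u i) ^+ 2 / (dotv (u i) (v i)) ^+ 2).
Definition beta_xbxi : R :=
  2 / lA3 * bmax (fun i : 'I_N => (n i)%:R * sumL2 i).
Definition b0 (i : 'I_N) : R :=
  (n i)%:R + (((n i)%:R)^-1 + bmax (fun k : 'I_N => (n k)%:R)) * vnorm (v i) ^+ 2 * sumL2 i.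
Definition b1 (i : 'I_N) : R :=
  vnorm (u i) ^+ 2 / ((n i)%:R * dotv (u i) (v i)) * b0 i.
Definition b2 (i : 'I_N) : R :=
  nsumR * (4 * opnorm (M^T *m WM) ^+ 2 + 2 * opnorm WM)
  * opnorm ((((n i)%:R ^+ 2)^-1) *: (ones R (n i) *m (u i)^T)) ^+ 2 * b0 i.
Definition b3 (i : 'I_N) : R :=
  (((n i)%:R ^+ 2)^-1) *
  (2 * opnorm ((Rbar (Rw i) (u i))^T *m WR i *m Ibar_u (u i)) ^+ 2
   + opnorm ((Ibar_u (u i))^T *m WR i *m Ibar_u (u i))) * b0 i.
Definition gamma1 : R := 4 * beta_xbpsi.
Definition gamma2 : R := 4 * (beta_xbxi + beta_psixi * gamma1).
Definition gamma3 : R := 4 * (beta_psix * gamma1 + beta_xix * gamma2).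
Definition sigma : R := bmax b1 + gamma2 * bmax b2 + gamma3 * bmax b3.
Definition alpha_bound : R :=
  Num.min (Num.min (lA3 / (2 * N%:R * sigma)) (gamma1 / (8 * sigma)))
          (Num.min (gamma2 / (8 * sigma)) 1).
End Constants.

(* Main.v *)
(* Replace each local state by its deviation: [err_psi] of the gradient trackers
   from their consensus direction [v_i], [err_x] of [x_i] from the [u_i]-weighted
   mean, [err_xi] of the estimates from the expanded means, and [xmean - y], where
   [y] is the zero of the pseudogradient [Qmap].  Each of the first three obeys a
   linear recursion with a Schur matrix plus an input, so its Lyapunov form loses
   half of the squared error per step up to an input term; the form of [xmean - y]
   loses [alpha l] times its square by strong monotonicity.  All inputs are bounded by
   the other errors, and the weights [1], [gamma1], [gamma2], [gamma3] make the
   combined function decrease by a multiple of the squared errors, which therefore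
   tend to zero. *)
Require Import Defs.
From HB Require Import structures.
From mathcomp Require Import all_boot all_order all_algebra.
From mathcomp Require Import all_classical all_reals all_analysis.
From mathcomp Require Import ring lra.
Import Order.TTheory GRing.Theory Num.Theory.
Import numFieldNormedType.Exports.
Set Implicit Arguments. Unset Strict Implicit. Unset Printing Implicit Defensive.
Local Open Scope ring_scope.
Local Open Scope classical_set_scope.

(** Up to terms of order [alpha ^+ 2], the couplings are triangular: the mean is driven by the [psi]
    and [xi] errors, [psi] by those of [xi] and [x], [xi] by that of [x], and [x] by none. Hence
    each of [gamma1], [gamma2], [gamma3] can be four times what the inequalities weighted before it
    charge to its error: that charge then costs a quarter of the weight, out of the half that is
    lost. The feedback closing the loop passes through [psisum] and carries [alpha ^+ 2]; [sigma] is
    its total weight, and the bounds on [alpha] absorb it.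

    The mean of coalition [i] follows the pseudogradient with effective step
    [alpha * dotv (u i) (v i) / (n i)%:R ^+ 3], which differs between coalitions, whereas strong
    monotonicity controls only the unweighted sum over them. The inverse factors are therefore built
    into [Vy]. This needs [0 < dotv (u i) (v i)], a Perron-Frobenius fact drawn from the strong
    connectivity of each coalition graph. *)

Section Euclid.
Variable R : realType.

(** * Euclidean norms, operator norms and Lyapunov forms *)

Lemma sum_sqr_ge0 (I : finType) (a : I -> R) : 0 <= \sum_i a i ^+ 2.
Proof. by apply: sumr_ge0 => i _; exact: sqr_ge0. Qed.

(** The sum of the squares [(B * a i - C * b i) ^+ 2] equals [B * (A * B - C ^+ 2)]; the factor [B]
    cancels unless it is zero, and then every [b i] vanishes. *)
Lemma cauchy_schwarz_sum (I : finType) (a b : I -> R) :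
  (\sum_i a i * b i) ^+ 2 <= (\sum_i a i ^+ 2) * (\sum_i b i ^+ 2).
Proof.
set A := \sum_i a i ^+ 2; set B := \sum_i b i ^+ 2; set C := \sum_i a i * b i.
have B0 : 0 <= B by exact: sum_sqr_ge0.
have key : 0 <= B * (A * B - C ^+ 2).
  have -> : B * (A * B - C ^+ 2) = \sum_i (B * a i - C * b i) ^+ 2.
    rewrite [RHS](eq_bigr (fun i => B ^+ 2 * a i ^+ 2 - 2 * B * C * (a i * b i)
                              + C ^+ 2 * b i ^+ 2)); last by move=> i _; ring.
    rewrite big_split /= sumrB -!mulr_sumr -/A -/B -/C; ring.
  exact: sum_sqr_ge0.
have [B00|Bn0] := eqVneq B 0; last first.
  by rewrite -subr_ge0 -(pmulr_rge0 _ (_ : 0 < B)) // lt0r Bn0.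
suff -> : C = 0 by rewrite expr0n B00 mulr0.
have b0 i : b i = 0.
  by apply/eqP; rewrite -sqrf_eq0; apply/eqP; apply: (psumr_eq0P _ B00) => // j _; exact: sqr_ge0.
by rewrite /C big1 // => i _; rewrite b0 mulr0.
Qed.

Lemma sqr_sum_le (I : finType) (a : I -> R) :
  (\sum_i a i) ^+ 2 <= #|I|%:R * \sum_i a i ^+ 2.
Proof.
have h := cauchy_schwarz_sum (fun=> 1) a.
have e1 : \sum_i 1 * a i = \sum_i a i by apply: eq_bigr => i _; rewrite mul1r.
have e2 : \sum_(i : I) (1 : R) ^+ 2 = #|I|%:R by rewrite expr1n sumr_const.
by rewrite e1 e2 in h.
Qed.

Lemma vnorm_sqr n (v : 'cV[R]_n) : vnorm v ^+ 2 = \sum_k v k 0 ^+ 2.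
Proof. by rewrite sqr_sqrtr // sum_sqr_ge0. Qed.

Lemma rnorm_sqr n (v : 'rV[R]_n) : rnorm v ^+ 2 = \sum_k v 0 k ^+ 2.
Proof. by rewrite sqr_sqrtr // sum_sqr_ge0. Qed.

Lemma vnorm_ge0 n (v : 'cV[R]_n) : 0 <= vnorm v.
Proof. exact: sqrtr_ge0. Qed.

Lemma rnorm_ge0 n (v : 'rV[R]_n) : 0 <= rnorm v.
Proof. exact: sqrtr_ge0. Qed.

Lemma vnorm_eq0 n (v : 'cV[R]_n) : (vnorm v == 0) = (v == 0).
Proof.
rewrite -sqrf_eq0 vnorm_sqr; apply/eqP/eqP => [h|->]; last first.
  by rewrite big1 // => k _; rewrite mxE expr0n.
apply/matrixP => k j; rewrite ord1 mxE; apply/eqP; rewrite -sqrf_eq0; apply/eqP.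
by apply: (psumr_eq0P _ h) => // i _; exact: sqr_ge0.
Qed.

Lemma vnormZ n (c : R) (v : 'cV[R]_n) : vnorm (c *: v) = `|c| * vnorm v.
Proof.
apply/eqP; rewrite -(eqrXn2 (n := 2)) ?mulr_ge0 ?vnorm_ge0 //.
rewrite exprMn real_normK ?num_real // !vnorm_sqr mulr_sumr; apply/eqP.
by apply: eq_bigr => k _; rewrite mxE exprMn.
Qed.

Lemma dotvE n (a b : 'cV[R]_n) : dotv a b = \sum_k a k 0 * b k 0.
Proof. by rewrite /dotv mxE; apply: eq_bigr => k _; rewrite mxE. Qed.

Lemma dotv_le n (a b : 'cV[R]_n) : `|dotv a b| <= vnorm a * vnorm b.
Proof.
rewrite -(ler_pXn2r (n := 2)) ?nnegrE ?mulr_ge0 ?vnorm_ge0 //.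
rewrite exprMn real_normK ?num_real // !vnorm_sqr dotvE.
exact: cauchy_schwarz_sum.
Qed.

Lemma dotv_sqr_le n (a b : 'cV[R]_n) : dotv a b ^+ 2 <= vnorm a ^+ 2 * vnorm b ^+ 2.
Proof. by rewrite dotvE !vnorm_sqr; exact: cauchy_schwarz_sum. Qed.

Lemma vnormD_sqr n (a b : 'cV[R]_n) :
  vnorm (a + b) ^+ 2 <= 2 * (vnorm a ^+ 2 + vnorm b ^+ 2).
Proof.
rewrite !vnorm_sqr -big_split mulr_sumr; apply: ler_sum => k _ /=; rewrite mxE.
have := sqr_ge0 (a k 0 - b k 0); nra.
Qed.

(** A [sup] is meaningful only on a nonempty bounded set; Cauchy-Schwarz on each row gives the
    Frobenius norm as a bound. *)
Lemma opnorm_has_sup m n (A : 'M[R]_(m, n)) :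
  has_sup [set r | exists v : 'cV[R]_n, vnorm v <= 1 /\ r = vnorm (A *m v)].
Proof.
split.
  exists 0; exists 0; have z k : vnorm (0 : 'cV[R]_k) = 0 by apply/eqP; rewrite vnorm_eq0.
  by rewrite mulmx0 !z.
set F := \sum_i \sum_j A i j ^+ 2.
have F0 : 0 <= F by apply: sumr_ge0 => i _; exact: sum_sqr_ge0.
exists (Num.sqrt F) => r [v [v1 ->]].
rewrite ler_sqrt // (_ : \sum__ _ = \sum_i (\sum_j A i j * v j 0) ^+ 2); last first.
  by apply: eq_bigr => i _; rewrite mxE.
apply: ler_sum => i _; apply: (le_trans (cauchy_schwarz_sum _ _)).
rewrite ler_piMr ?sum_sqr_ge0 // -vnorm_sqr.
by rewrite exprn_ile1 ?vnorm_ge0.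
Qed.

Lemma opnorm_ub m n (A : 'M[R]_(m, n)) v : vnorm v <= 1 -> vnorm (A *m v) <= opnorm A.
Proof.
move=> v1; have [_ hb] := opnorm_has_sup A.
by apply: (ub_le_sup hb); exists v.
Qed.

Lemma opnorm_ge0 m n (A : 'M[R]_(m, n)) : 0 <= opnorm A.
Proof.
apply: (le_trans _ (opnorm_ub (v := 0) A _)); first exact: vnorm_ge0.
by rewrite (_ : vnorm _ = 0) //; apply/eqP; rewrite vnorm_eq0.
Qed.

Lemma vnorm_mulmx_le m n (A : 'M[R]_(m, n)) v : vnorm (A *m v) <= opnorm A * vnorm v.
Proof.
have [->|v0] := eqVneq v 0.
  by rewrite mulmx0 (_ : vnorm (0 : 'cV_m) = 0) ?mulr_ge0 ?vnorm_ge0 ?opnorm_ge0 //;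
    apply/eqP; rewrite vnorm_eq0.
have vp : 0 < vnorm v by rewrite lt0r vnorm_eq0 v0 vnorm_ge0.
rewrite -ler_pdivrMr //.
have -> : vnorm (A *m v) / vnorm v = vnorm (A *m ((vnorm v)^-1 *: v)).
  by rewrite -scalemxAr vnormZ ger0_norm ?invr_ge0 ?vnorm_ge0 // mulrC.
apply: opnorm_ub; rewrite vnormZ ger0_norm ?invr_ge0 ?vnorm_ge0 //.
by rewrite mulVf ?gt_eqF.
Qed.

Lemma vnorm_mulmx_sqr_le m n (A : 'M[R]_(m, n)) v :
  vnorm (A *m v) ^+ 2 <= opnorm A ^+ 2 * vnorm v ^+ 2.
Proof.
rewrite -exprMn ler_pXn2r ?nnegrE ?mulr_ge0 ?vnorm_ge0 ?opnorm_ge0 //.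
exact: vnorm_mulmx_le.
Qed.

Lemma opnorm_gt0 m n (A : 'M[R]_(m, n)) : A != 0 -> 0 < opnorm A.
Proof.
move=> A0; rewrite lt0r opnorm_ge0 andbT; apply: contra_neq A0 => oA.
apply/matrixP => i j; rewrite mxE.
have : vnorm (A *m delta_mx j 0) == 0.
  by rewrite eq_le vnorm_ge0 andbT (le_trans (vnorm_mulmx_le _ _)) // oA mul0r.
rewrite vnorm_eq0 -colE => /eqP/matrixP/(_ i 0).
by rewrite !mxE.
Qed.

Definition quad n (W : 'M[R]_n) (e : 'cV[R]_n) : R := dotv e (W *m e).

Lemma quad_ge0 n (W : 'M[R]_n) e : sym_pd W -> 0 <= quad W e.
Proof.
move=> [_ h]; have [->|e0] := eqVneq e 0; first by rewrite /quad mulmx0 /dotv mulmx0 mxE.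
by rewrite /quad /dotv mulmxA ltW // h.
Qed.

Lemma dotvDl n (a b c : 'cV[R]_n) : dotv (a + b) c = dotv a c + dotv b c.
Proof. by rewrite /dotv linearD /= mulmxDl mxE. Qed.
Lemma dotvDr n (a b c : 'cV[R]_n) : dotv c (a + b) = dotv c a + dotv c b.
Proof. by rewrite /dotv mulmxDr mxE. Qed.
Lemma dotvC n (a b : 'cV[R]_n) : dotv a b = dotv b a.
Proof. by rewrite !dotvE; apply: eq_bigr => k _; rewrite mulrC. Qed.
Lemma dotv_mulmxl m n (A : 'M[R]_(m, n)) a b : dotv (A *m a) b = dotv a (A^T *m b).
Proof. by rewrite /dotv trmx_mul mulmxA. Qed.
Lemma dotvv n (a : 'cV[R]_n) : dotv a a = vnorm a ^+ 2.
Proof. by rewrite dotvE vnorm_sqr; apply: eq_bigr => k _; rewrite expr2. Qed.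
Lemma dotvNr n (a b : 'cV[R]_n) : dotv a (- b) = - dotv a b.
Proof. by rewrite /dotv mulmxN mxE. Qed.

(** By the Lyapunov equation, [A] alone costs the form exactly [vnorm e ^+ 2]. Young's inequality
    spends half of this on the cross term, leaving [2 * opnorm (A^T *m W *m B) ^+ 2] on the input.
    The Lyapunov products in [beta_psixi], [beta_xix], [b2] and [b3] all come from this bracket. *)
Lemma quad_step n p (A W : 'M[R]_n) (B : 'M[R]_(n, p)) e d :
  sym_pd W -> A^T *m W *m A - W = - 1%:M ->
  quad W (A *m e + B *m d) <= quad W e - 2^-1 * vnorm e ^+ 2
    + (2 * opnorm (A^T *m W *m B) ^+ 2 + opnorm (B^T *m W *m B)) * vnorm d ^+ 2.
Proof.
move=> [Wsym _] lyap.
have lyapE : quad W (A *m e) = quad W e - vnorm e ^+ 2.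
  rewrite /quad dotv_mulmxl !mulmxA.
  have -> : A^T *m W *m A = W - 1%:M by rewrite -lyap addrC subrK.
  by rewrite mulmxBl mul1mx dotvDr dotvNr dotvv.
have -> : quad W (A *m e + B *m d) = quad W (A *m e)
    + 2 * dotv e (A^T *m W *m B *m d) + dotv d (B^T *m W *m B *m d).
  rewrite /quad mulmxDr dotvDl !dotvDr.
  have -> : dotv (B *m d) (W *m (A *m e)) = dotv (A *m e) (W *m (B *m d)).
    by rewrite dotvC dotv_mulmxl Wsym.
  rewrite [dotv (A *m e) (W *m (B *m d))]dotv_mulmxl.
  rewrite [dotv (B *m d) (W *m (B *m d))]dotv_mulmxl !mulmxA; ring.
set P := A^T *m W *m B; set Q := B^T *m W *m B.
have h1 : dotv e (P *m d) <= vnorm e * (opnorm P * vnorm d).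
  apply: (le_trans (ler_norm _)); apply: (le_trans (dotv_le _ _)).
  by rewrite ler_wpM2l ?vnorm_ge0 // vnorm_mulmx_le.
have h2 : dotv d (Q *m d) <= opnorm Q * vnorm d ^+ 2.
  apply: (le_trans (ler_norm _)); apply: (le_trans (dotv_le _ _)).
  rewrite expr2 mulrCA ler_wpM2l ?vnorm_ge0 // vnorm_mulmx_le //.
rewrite lyapE.
have := sqr_ge0 (vnorm e - 2 * (opnorm P * vnorm d)); nra.
Qed.

End Euclid.

(** * Positivity of fixed vectors of irreducible stochastic matrices *)

Section Perron.
Variables (R : realType) (m : nat).

(* Compare [w] with its entrywise absolute value: both are fixed, hence so is
   the nonnegative vector [|w| - w], which irreducibility forces to vanish. *)
Lemma stochastic_fixed_gt0 (P : 'M[R]_m) (w : 'cV[R]_m) (e : rel 'I_m) :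
  (forall i j, 0 <= P i j) -> (forall i, \sum_j P i j = 1) ->
  (forall i j, e i j -> 0 < P i j) -> (forall i j, connect e i j) ->
  (forall j, \sum_i w i 0 * P i j = w j 0) -> 0 < \sum_j w j 0 ->
  forall j, 0 < w j 0.
Proof.
move=> P0 P1 eP conn fix_w sum_w.
(* Positivity travels along an edge: in [\sum_i z i * P i j] no term is negative and that of the
   predecessor is positive. *)
have spread (z : 'I_m -> R) : (forall j, 0 <= z j) ->
    (forall j, \sum_i z i * P i j = z j) -> forall i j, 0 < z i -> 0 < z j.
  move=> z0 fz i j zi; have /connectP[s es ->] := conn i j.
  elim: s i zi es => [|a s IH] i zi //= /andP[eia es]; apply: IH es.
  rewrite -(fz a) (bigD1 i) //= ltr_pwDl ?mulr_gt0 ?eP //.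
  by apply: sumr_ge0 => k _; rewrite mulr_ge0.
have abs_le j : `|w j 0| <= \sum_i `|w i 0| * P i j.
  rewrite -{1}fix_w; apply: (le_trans (ler_norm_sum _ _ _)); apply: ler_sum => i _.
  by rewrite normrM (ger0_norm (P0 _ _)).
(* Since the rows of [P] sum to 1, both sides of [abs_le] have the same total, so each inequality is
   an equality. *)
have abs_sum : \sum_j (\sum_i `|w i 0| * P i j - `|w j 0|) = 0.
  rewrite sumrB exchange_big /=; apply/eqP; rewrite subr_eq0; apply/eqP.
  by apply: eq_bigr => i _; rewrite -mulr_sumr P1 mulr1.
have abs_fix j : \sum_i `|w i 0| * P i j = `|w j 0|.
  apply/eqP; rewrite -subr_eq0; apply/eqP.
  by apply: (psumr_eq0P _ abs_sum) => // i _; rewrite subr_ge0.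
have [j0 wj0] : exists j, 0 < w j 0.
  apply/not_existsP => h; move: sum_w; rewrite ltNge => /negP; apply.
  by apply: sumr_le0 => j _; rewrite leNgt; apply/negP/h.
(* A positive gap at [j] would spread to [j0], where [w] is positive and the gap is zero. *)
have z_eq0 j : `|w j 0| - w j 0 = 0.
  apply/eqP; rewrite eq_le subr_ge0 ler_norm andbT leNgt; apply/negP => zj.
  have := @spread (fun j => `|w j 0| - w j 0) _ _ j j0 zj.
  rewrite gtr0_norm // subrr ltxx => /(_ _ _)/notF; apply=> [k|k].
    by rewrite subr_ge0 ler_norm.
  rewrite -[in RHS]abs_fix -[X in _ = _ - X]fix_w -sumrB.
  by apply: eq_bigr => i _; rewrite mulrBl.
have w_ge0 j : 0 <= w j 0.
  by move/eqP: (z_eq0 j); rewrite subr_eq0 => /eqP <-.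
by move=> j; exact: (spread (fun j => w j 0) w_ge0 fix_w j0 j wj0).
Qed.

End Perron.

(** * Limits, zeros of strongly monotone maps, and convexity *)

Section Zero.
Variable R : realType.

Lemma cvg_sqr0 (u : R ^nat) : u @ \oo --> 0 -> (fun k => u k ^+ 2) @ \oo --> 0.
Proof.
move=> h; have -> : (fun k => u k ^+ 2) = u \* u by apply/funext => k; rewrite expr2.
by have := cvgM h h; rewrite mulr0; exact.
Qed.

Lemma cvg_sum0 (I : finType) (u : I -> R ^nat) :
  (forall i, u i @ \oo --> 0) -> (fun k => \sum_i u i k) @ \oo --> 0.
Proof.
move=> h; have := @cvg_big _ _ _ 0 xpredT (@add_continuous R) _ _ (index_enum I) u (fun=> 0) _.
by rewrite big1 // => H; apply: H => i _; exact: h.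
Qed.

Lemma cvg_geometric_steps (u : R ^nat) (c r : R) : 0 <= r < 1 ->
  (forall k, `|u k.+1 - u k| <= c * r ^+ k) -> cvgn u.
Proof.
move=> /andP[r0 r1] ub.
have -> : u = (fun k => u 0%N + series (telescope u) k).
  by apply/funext => k; rewrite -eq_sum_telescope.
apply: is_cvgD; first exact: is_cvg_cst.
apply: normed_cvg; apply: (@series_le_cvg _ _ (geometric c r)) => //=.
- move=> k; apply: (le_trans (normr_ge0 _) (ub k)).
- by apply: is_cvg_geometric_series; rewrite ger0_norm.
Qed.

(* The zero is the limit of the iteration [y - t Q(y)], a contraction of ratio
   [1 - l^2/K] in the squared Euclidean norm when [t = l/K]. *)
Lemma strongly_monotone_zero N (Q : 'rV[R]_N -> 'rV[R]_N) (l K : R) : 0 < l ->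
  (forall a b, l * rnorm (a - b) ^+ 2 <= \sum_k (a - b) 0 k * (Q a - Q b) 0 k) ->
  (forall a b, rnorm (Q a - Q b) ^+ 2 <= K * rnorm (a - b) ^+ 2) ->
  exists y, Q y = 0.
Proof.
move=> l0 mono lipK.
(* Adding [l ^+ 2] to [|K|] keeps the ratio [q] in [[0, 1[] whatever the size or sign of [K]. *)
pose K' := `|K| + l ^+ 2.
have l20 : 0 < l ^+ 2 by rewrite exprn_gt0.
have K'0 : 0 < K' by rewrite ltr_wpDl.
have lip a b : rnorm (Q a - Q b) ^+ 2 <= K' * rnorm (a - b) ^+ 2.
  apply: (le_trans (lipK a b)); rewrite ler_wpM2r ?sqr_ge0 //.
  by rewrite (le_trans (ler_norm _)) // lerDl ltW.
pose t := l / K'; pose q := 1 - l ^+ 2 / K'.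
have t0 : 0 < t by rewrite divr_gt0.
have q01 : 0 <= q < 1.
  rewrite subr_ge0 ler_pdivrMr // mul1r lerDr normr_ge0 /=.
  by rewrite ltrBlDr ltrDl divr_gt0.
pose T a := a - t *: Q a.
have contr a b : rnorm (T a - T b) ^+ 2 <= q * rnorm (a - b) ^+ 2.
  have -> : rnorm (T a - T b) ^+ 2 = rnorm (a - b) ^+ 2
     - 2 * t * (\sum_k (a - b) 0 k * (Q a - Q b) 0 k) + t ^+ 2 * rnorm (Q a - Q b) ^+ 2.
    rewrite !rnorm_sqr !mulr_sumr -sumrB -big_split; apply: eq_bigr => k _ /=.
    by rewrite !mxE; ring.
  have -> : q * rnorm (a - b) ^+ 2 = rnorm (a - b) ^+ 2
      - 2 * t * (l * rnorm (a - b) ^+ 2) + t ^+ 2 * (K' * rnorm (a - b) ^+ 2).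
    by rewrite /q /t; field; rewrite gt_eqF.
  apply: lerD; last by rewrite ler_pM2l ?exprn_gt0.
  by rewrite lerD2l lerN2 ler_pM2l //; apply: mulr_gt0.
pose y k := iter k T 0; pose c := rnorm (y 1%N - y 0%N) ^+ 2.
have step k : rnorm (y k.+1 - y k) ^+ 2 <= q ^+ k * c.
  elim: k => [|k IH]; first by rewrite expr0 mul1r.
  apply: (le_trans (contr _ _)); rewrite (exprS q) -mulrA ler_wpM2l //.
  by case/andP: q01.
have ycvg i : cvgn (fun k => y k 0 i).
  apply: (@cvg_geometric_steps _ (Num.sqrt c) (Num.sqrt q)).
    case/andP: q01 => q0 q1; rewrite sqrtr_ge0 /=.
    by rewrite -[ltRHS]sqrtr1 ltr_sqrt.
  move=> k; rewrite -(ler_pXn2r (n := 2)) ?nnegrE ?mulr_ge0 ?exprn_ge0 ?sqrtr_ge0 //.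
  have q0 : 0 <= q by case/andP: q01.
  rewrite exprMn exprAC !sqr_sqrtr ?sqr_ge0 // real_normK ?num_real //.
  rewrite mulrC; apply: le_trans (step k); rewrite rnorm_sqr (bigD1 i) //= !mxE.
  by rewrite lerDl sumr_ge0 // => j _; exact: sqr_ge0.
pose z : 'rV[R]_N := \row_i limn (fun k => y k 0 i).
have yz i : (fun k => y k 0 i - z 0 i) @ \oo --> 0.
  by rewrite -(subrr (z 0 i)); apply: cvgB; [rewrite mxE; exact: ycvg|exact: cvg_cst].
exists z.
(* [Q z] splits into [Q z - Q (y k)], controlled by the Lipschitz bound, and [Q (y k)], which is
   [(y k - y k.+1) / t]; both parts tend to zero. *)
pose e k := 2 * K' * (\sum_i (y k 0 i - z 0 i) ^+ 2)
   + 2 * t ^- 2 * (\sum_i ((y k.+1 0 i - z 0 i) - (y k 0 i - z 0 i)) ^+ 2).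
have e0 : e @ \oo --> 0.
  rewrite /e [X in _ --> X](_ : 0 = 2 * K' * 0 + 2 * t ^- 2 * 0); last by rewrite !mulr0 addr0.
  apply: cvgD; apply: cvgM; try exact: cvg_cst.
    by apply: (@cvg_sum0 _ (fun i k => (y k 0 i - z 0 i) ^+ 2)) => i; exact: cvg_sqr0.
  apply: (@cvg_sum0 _ (fun i k => ((y k.+1 0 i - z 0 i) - (y k 0 i - z 0 i)) ^+ 2)) => i.
  apply: cvg_sqr0; rewrite -[X in _ --> X](subrr (0 : R)); apply: cvgB; last exact: yz.
  by have := yz i; rewrite -(cvg_shiftS (fun k => y k 0 i - z 0 i)).
have bound k : rnorm (Q z) ^+ 2 <= e k.
  have s : rnorm (Q z) ^+ 2 <= 2 * (rnorm (Q (y k) - Q z) ^+ 2 + rnorm (Q (y k)) ^+ 2).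
    rewrite !rnorm_sqr -big_split mulr_sumr; apply: ler_sum => i _ /=; rewrite !mxE.
    by have := sqr_ge0 (2 * Q (y k) 0 i - Q z 0 i); nra.
  apply: (le_trans s); rewrite mulrDr lerD // -mulrA ler_pM2l //.
    by apply: (le_trans (lip _ _)); rewrite rnorm_sqr le_eqVlt; apply/orP; left;
      apply/eqP; congr (_ * _); apply: eq_bigr => i _; rewrite !mxE.
  rewrite rnorm_sqr mulr_sumr; apply: ler_sum => i _.
  rewrite [y k.+1]iterS -/(y k) /T !mxE le_eqVlt; apply/orP; left; apply/eqP.
  by field; rewrite gt_eqF.
have Qz0 : rnorm (Q z) ^+ 2 <= 0.
  by apply: (cvgr_to_ge e0); apply: nearW => k; exact: bound.
apply/matrixP => i j; rewrite ord1 mxE; apply/eqP; rewrite -sqrf_eq0; apply/eqP.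
have /psumr_eq0P -> // : \sum_k Q z 0 k ^+ 2 = 0.
  by apply/eqP; rewrite -rnorm_sqr eq_le Qz0 sqr_ge0.
by move=> k _; exact: sqr_ge0.
Qed.

(** Bridges the Euclidean estimates, which bound squared entries, and the topology of row vectors,
    whose balls are entrywise. *)
Lemma cvg_row_sqr n (u : nat -> 'rV[R]_n) (z : 'rV[R]_n) (e : R ^nat) :
  e @ \oo --> 0 -> (forall k i, (u k 0 i - z 0 i) ^+ 2 <= e k) -> u @ \oo --> z.
Proof.
move=> e0 ub; apply/cvg_ballP => d d0.
have d20 : 0 < d ^+ 2 by rewrite exprn_gt0.
near=> k; split=> // a i; rewrite ord1 /ball /= distrC.
rewrite -(ltr_pXn2r (n := 2)) ?nnegrE ?(ltW d0) // real_normK ?num_real //.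
apply: (le_lt_trans (ub k i)).
near: k; exact: (cvgr_lt _ e0).
Unshelve. all: by end_near. Qed.

(** Convexity bounds the difference quotient by [g (a + w) - g a] only for steps in []0, 1]], so the
    derivative is taken as a limit from the right. *)
Lemma convex_derive_le n (g : 'rV[R]_n -> R) a w :
  convex_fun g -> differentiable g a -> 'D_w g a <= g (a + w) - g a.
Proof.
move=> cg dg.
have dw := diff_derivable (v := w) dg.
have cvgD : (fun h => h^-1 *: ((g \o shift a) (h *: w) - g a)) @ 0^'+ --> 'D_w g a.
  exact: cvg_dnbhs_at_right dw.
apply: (cvgr_to_le cvgD); near=> h.
have h0 : 0 < h by near: h; exact: nbhs_right_gt.
have h1 : h <= 1 by near: h; exact: nbhs_right_le.
rewrite /= /GRing.scale /= ler_pdivrMl //.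
have := cg (a + w) a h; rewrite h1 (ltW h0) => /(_ isT).
rewrite (_ : h *: (a + w) + (1 - h) *: a = h *: w + a); last first.
  by rewrite scalerDr scalerBl scale1r addrC addrA subrK addrC.
by move=> hc; lra.
Unshelve. all: by end_near. Qed.

End Zero.

(** * The pseudogradient and the Nash equilibrium *)

Section Game.
Variables (R : realType) (N : nat) (n : 'I_N -> nat).
Local Notation Ag := (Agent n).
Local Notation nsum := #|{: Ag}|.
Local Notation ex := (@Defs.expand R N n).

Lemma sum_enum_val (V : nmodType) (T : finType) (F : T -> V) :
  \sum_(s < #|{: T}|) F (enum_val s) = \sum_(a : T) F a.
Proof.
rewrite (reindex (@enum_rank T)) /=; last exact: onW_bij (enum_rank_bij T).
by apply: eq_bigr => a _; rewrite enum_rankK.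
Qed.

Lemma sum_agent (V : nmodType) (F : Ag -> V) :
  \sum_(a : Ag) F a = \sum_i \sum_(j < n i) F (ag j).
Proof.
rewrite (sig_big_dep xpredT (fun=> xpredT) (fun i (j : 'I_(n i)) => F (ag j))) /=.
by apply: eq_bigr => -[i j].
Qed.

Lemma pos_inj : injective (@pos N n).
Proof. exact: enum_rank_inj. Qed.

Lemma ag_inj i : injective (@ag N n i).
Proof. by move=> j j' /eqP; rewrite -tag_eqE /tag_eq eqxx tagged_asE => /eqP. Qed.

Lemma expand_pos (y : 'rV[R]_N) (a : Ag) : ex y 0 (pos a) = y 0 (tag a).
Proof. by rewrite mxE enum_rankK. Qed.

Lemma expand_delta (i : 'I_N) :
  ex (delta_mx 0 i) = \sum_(l < n i) delta_mx 0 (pos (ag l)).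
Proof.
apply/rowP => s; rewrite -(enum_valK s) expand_pos summxE mxE eqxx /=.
case: (enum_val s) => p q /=; case: eqP => [pi|pi].
  subst p; rewrite (bigD1 q) //= mxE !eqxx /= big1 ?addr0 // => l lq.
  by rewrite mxE (inj_eq pos_inj) (inj_eq (@ag_inj _)) eq_sym (negbTE lq).
rewrite big1 // => l _; rewrite mxE (inj_eq pos_inj) eqxx /=.
by case: eqP => // -[e _]; case: pi.
Qed.

(** Expansion repeats coordinate [i] exactly [n i] times; this is the origin of the maximal
    coalition size in [b0]. *)
Lemma rnorm_expand_le (a b : 'rV[R]_N) :
  rnorm (ex a - ex b) ^+ 2
    <= bmax (fun k => (n k)%:R) * rnorm (a - b) ^+ 2.
Proof.
rewrite !rnorm_sqr mulr_sumr.
rewrite (eq_bigr (fun s => (a 0 (tag (enum_val s)) - b 0 (tag (enum_val s))) ^+ 2)).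
  rewrite (sum_enum_val (fun c : Ag => (a 0 (tag c) - b 0 (tag c)) ^+ 2)) sum_agent.
  apply: ler_sum => i _; rewrite /= sumr_const card_ord !mxE -[leLHS]mulr_natl.
  rewrite ler_wpM2r ?sqr_ge0 //; exact: (le_bigmax _ (fun k => (n k)%:R : R) i).
by move=> s _; rewrite !mxE.
Qed.

Lemma partial_lipschitz_sum (g : 'rV[R]_nsum -> R) (L : R) i a b :
  grad_lipschitz g L ->
  \sum_(l < n i) (partial g (pos (ag l)) a - partial g (pos (ag l)) b) ^+ 2
    <= L ^+ 2 * rnorm (a - b) ^+ 2.
Proof.
move=> /(_ a b) h.
have : rnorm (gradient g a - gradient g b) ^+ 2 <= L ^+ 2 * rnorm (a - b) ^+ 2.
  rewrite -exprMn ler_pXn2r ?nnegrE ?rnorm_ge0 // (le_trans (rnorm_ge0 _) h) //.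
apply: le_trans; rewrite rnorm_sqr.
rewrite (eq_bigr (fun s => (partial g (pos (enum_val s)) a - partial g (pos (enum_val s)) b) ^+ 2)).
  rewrite (sum_enum_val (fun c : Ag => (partial g (pos c) a - partial g (pos c) b) ^+ 2)).
  rewrite sum_agent (bigD1 i) //= lerDl; apply: sumr_ge0 => k _; exact: sum_sqr_ge0.
by move=> s _; rewrite !mxE /pos enum_valK.
Qed.

Section Costs.
Variables (f : forall i, 'I_(n i) -> 'rV[R]_nsum -> R) (lij : forall i, 'I_(n i) -> R).
Arguments f : clear implicits.
Arguments lij : clear implicits.
Hypothesis fdiff : forall i j a, differentiable (f i j) a.
Hypothesis fconv : forall i j, convex_fun (f i j).
Hypothesis flip : forall i j, grad_lipschitz (f i j) (lij i j).

(** The evaluation points depend on [j] because each agent differentiates at its own estimate.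
    Cauchy-Schwarz over the partials gives [n i]; a second one over the agents, pairing [lij i j]
    with the distances, gives the sum of the squared constants. *)
Lemma pseudogradient_sum_lipschitz i (a b : 'I_(n i) -> 'rV[R]_nsum) :
  (\sum_j \sum_(l < n i) (partial (f i j) (pos (ag l)) (a j)
                         - partial (f i j) (pos (ag l)) (b j))) ^+ 2
  <= (n i)%:R * (\sum_j lij i j ^+ 2) * \sum_j rnorm (a j - b j) ^+ 2.
Proof.
set S := fun j => \sum_(l < n i) (partial (f i j) (pos (ag l)) (a j)
                         - partial (f i j) (pos (ag l)) (b j)).
have S2 j : S j ^+ 2 <= (n i)%:R * (lij i j ^+ 2 * rnorm (a j - b j) ^+ 2).
  apply: (le_trans (sqr_sum_le _)); rewrite card_ord ler_wpM2l //.
  exact: partial_lipschitz_sum.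
have S1 j : `|S j| <= Num.sqrt (n i)%:R * (`|lij i j| * rnorm (a j - b j)).
  rewrite -(ler_pXn2r (n := 2)) ?nnegrE ?mulr_ge0 ?sqrtr_ge0 ?rnorm_ge0 //.
  by rewrite real_normK ?num_real // !exprMn sqr_sqrtr // real_normK ?num_real.
have : `|\sum_j S j| <= Num.sqrt (n i)%:R * \sum_j (`|lij i j| * rnorm (a j - b j)).
  by rewrite mulr_sumr (le_trans (ler_norm_sum _ _ _)) //; apply: ler_sum => j _.
rewrite -(ler_pXn2r (n := 2)) ?nnegrE ?mulr_ge0 ?sqrtr_ge0 //; last first.
  by apply: sumr_ge0 => j _; rewrite mulr_ge0 ?rnorm_ge0.
rewrite real_normK ?num_real // exprMn sqr_sqrtr // => h; apply: (le_trans h).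
rewrite -mulrA ler_wpM2l //; apply: (le_trans (cauchy_schwarz_sum _ _)).
rewrite (eq_bigr (fun j => lij i j ^+ 2)) // => j _.
by rewrite real_normK ?num_real.
Qed.

Lemma derive_expand_delta (g : 'rV[R]_nsum -> R) i a : differentiable g a ->
  'D_(ex (delta_mx 0 i)) g a = \sum_(l < n i) partial g (pos (ag l)) a.
Proof.
move=> dg; rewrite deriveE // expand_delta linear_sum; apply: eq_bigr => l _.
by rewrite /partial deriveE.
Qed.

Lemma fcoalE i : fcoal f i = \sum_(j < n i) f i j.
Proof. by apply/funext => x; rewrite fct_sumE. Qed.

Lemma differentiable_fcoal i a : differentiable (fcoal f i) a.
Proof. by rewrite fcoalE; exact: differentiable_sum. Qed.

Lemma convex_fcoal i : convex_fun (fcoal f i).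
Proof.
move=> a b t t01; rewrite /fcoal !mulr_sumr -big_split.
by apply: ler_sum => j _; exact: fconv.
Qed.

Lemma derive_fcoal_delta i a :
  'D_(ex (delta_mx 0 i)) (fcoal f i) a
    = \sum_j \sum_(l < n i) partial (f i j) (pos (ag l)) a.
Proof.
rewrite fcoalE derive_sum; last by move=> j; exact: diff_derivable.
by apply: eq_bigr => j _; exact: derive_expand_delta.
Qed.

Lemma Qmap_sum y i :
  Qmap f y 0 i = \sum_j \sum_(l < n i) partial (f i j) (pos (ag l)) (ex y).
Proof.
rewrite mxE -derive_fcoal_delta /derive.
have shiftE h : gfun f i (h *: delta_mx 0 i + y) = fcoal f i (h *: ex (delta_mx 0 i) + ex y).
  by congr (fcoal f i _); apply/rowP => s; rewrite !mxE.
(* Instead of a chain rule: [expand] is linear, so the two difference quotients are the same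
   function. *)
suff -> : (fun h : R => h^-1 *: ((gfun f i \o shift y) (h *: delta_mx 0 i) - gfun f i y)) =
  (fun h => h^-1 *: ((fcoal f i \o shift (ex y)) (h *: ex (delta_mx 0 i)) - fcoal f i (ex y))).
  by [].
by apply/funext => h /=; rewrite shiftE.
Qed.

Lemma Qmap_lipschitz a b i : (Qmap f a - Qmap f b) 0 i ^+ 2 <=
  (n i)%:R ^+ 2 * bmax (fun k => (n k)%:R) * (\sum_j lij i j ^+ 2) * rnorm (a - b) ^+ 2.
Proof.
rewrite mxE [X in _ + X]mxE !Qmap_sum -sumrB.
under eq_bigr do rewrite -sumrB.
apply: (le_trans (pseudogradient_sum_lipschitz (fun=> _) (fun=> _))).
rewrite sumr_const card_ord -[rnorm (ex _ - _) ^+ 2 *+ _]mulr_natl.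
rewrite [leRHS](_ : _ = (n i)%:R * (\sum_j lij i j ^+ 2) *
  ((n i)%:R * (bmax (fun k => (n k)%:R) * rnorm (a - b) ^+ 2))); last by ring.
by rewrite ler_wpM2l ?mulr_ge0 ?sum_sqr_ge0 // ler_wpM2l // rnorm_expand_le.
Qed.

(** A unilateral consistent deviation moves [ex y] along [ex (delta_mx 0 i)]; by convexity the cost
    grows at least by the derivative there, a multiple of [Qmap f y 0 i], which is 0. *)
Lemma Qmap_zero_NE y : Qmap f y = 0 -> is_NE f (ex y).
Proof.
move=> Q0; split=> [i j j'|i theta]; first by rewrite !expand_pos.
set w := ex (delta_mx 0 i).
have -> : setblock (ex y) i theta = ex y + (theta - y 0 i) *: w.
  apply/rowP => s; rewrite !mxE eqxx /=; case: eqP => [->|_]; last by rewrite mulr0 addr0.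
  by rewrite mulr1 addrC subrK.
rewrite -subr_ge0; apply: le_trans (convex_derive_le _ (convex_fcoal i) (differentiable_fcoal i _)).
rewrite deriveE ?linearZ; last exact: differentiable_fcoal.
rewrite -deriveE; last exact: differentiable_fcoal.
by rewrite derive_fcoal_delta -Qmap_sum Q0 mxE /= /GRing.scale /= mulr0.
Qed.

Lemma exists_NE l : 0 < l ->
  (forall a b : 'rV[R]_N,
     \sum_(k < N) (a - b) 0 k * (Qmap f a - Qmap f b) 0 k >= l * rnorm (a - b) ^+ 2) ->
  exists y, Qmap f y = 0 /\ is_NE f (ex y).
Proof.
move=> l0 mono.
have [y Qy] : exists y, Qmap f y = 0.
  apply: (strongly_monotone_zero (l := l) (K := \sum_i
    (n i)%:R ^+ 2 * bmax (fun k => (n k)%:R) * (\sum_j lij i j ^+ 2))) => // a b.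
  by rewrite rnorm_sqr mulr_suml; apply: ler_sum => i _; exact: Qmap_lipschitz.
by exists y; split=> //; exact: Qmap_zero_NE.
Qed.

End Costs.
End Game.

(** * Weighted norms, averaging projections and the combined descent *)

Section Generic.
Variable R : realType.

(** Cauchy-Schwarz for [sqrt (p P) + sqrt (q Q)]. Unlike the bound with a factor 2, it only adds the
    constants, which gives [b0] its form as a plain sum. *)
Lemma vnormD_sqr_weighted m (a b : 'cV[R]_m) (p q P Q : R) :
  0 <= p -> 0 <= q -> 0 <= P -> 0 <= Q ->
  vnorm a ^+ 2 <= p * P -> vnorm b ^+ 2 <= q * Q ->
  vnorm (a + b) ^+ 2 <= (p + q) * (P + Q).
Proof.
move=> p0 q0 P0 Q0 ha hb.
rewrite -dotvv dotvDl !dotvDr (dotvC b a) !dotvv.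
have pQ : 0 <= p * Q by exact: mulr_ge0.
have qP : 0 <= q * P by exact: mulr_ge0.
suff : dotv a b <= (p * Q + q * P) / 2 by nra.
apply: (le_trans (ler_norm _)).
rewrite -(ler_pXn2r (n := 2)) ?nnegrE ?divr_ge0 ?addr_ge0 // real_normK ?num_real //.
apply: (le_trans (dotv_sqr_le _ _)).
apply: (le_trans (ler_pM (sqr_ge0 _) (sqr_ge0 _) ha hb)).
by have := sqr_ge0 (p * Q - q * P); nra.
Qed.

Lemma vnorm_sum_sqr_le m (I : finType) (F : I -> 'cV[R]_m) :
  vnorm (\sum_i F i) ^+ 2 <= #|I|%:R * \sum_i vnorm (F i) ^+ 2.
Proof.
rewrite vnorm_sqr (eq_bigr (fun k => (\sum_i F i k 0) ^+ 2)); last first.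
  by move=> k _; rewrite summxE.
rewrite [X in _ <= _ * X](eq_bigr (fun i => \sum_k F i k 0 ^+ 2)); last first.
  by move=> i _; rewrite vnorm_sqr.
rewrite exchange_big mulr_sumr; apply: ler_sum => k _; exact: sqr_sum_le.
Qed.

Lemma descent_cvg0 (V T : R ^nat) (c : R) : 0 < c ->
  (forall k, 0 <= V k) -> (forall k, 0 <= T k) ->
  (forall k, V k.+1 <= V k - c * T k) -> T @ \oo --> 0.
Proof.
move=> c0 V0 T0 dec.
have cV : cvgn V.
  apply: nonincreasing_is_cvgn; last by exists 0 => _ [k _ <-].
  apply/nonincreasing_seqP => k; apply: (le_trans (dec k)).
  by rewrite gerBl mulr_ge0 // ltW.
have dV : (fun k => c^-1 * (V k - V k.+1)) @ \oo --> 0.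
  rewrite -[X in _ --> X](mulr0 c^-1); apply: cvgM; first exact: cvg_cst.
  rewrite -[X in _ --> X](subrr (limn V)); apply: cvgB; first exact: cV.
  by move: cV; rewrite -(cvg_shiftS V).
apply: (squeeze_cvgr _ (cvg_cst 0) dV); apply: nearW => k; rewrite T0 /=.
by rewrite ler_pdivlMl // lerBrDr addrC -lerBrDr.
Qed.

Section Averaging.
Variable m : nat.
Hypothesis m0 : (0 < m)%N.
Implicit Types (C P : 'M[R]_m) (w : 'cV[R]_m).
Let mR : (m%:R : R) != 0. Proof. by rewrite pnatr_eq0 -lt0n. Qed.

Lemma tr_ones_mul (w : 'cV[R]_m) : (ones R m)^T *m w = (\sum_j w j 0)%:M.
Proof.
apply/matrixP => i j; rewrite !ord1 !mxE mulr1n; apply: eq_bigr => k _.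
by rewrite !mxE mul1r.
Qed.

(** Both [1^T C = 1^T] and [Cbar C w *m w = 0] hold, so the projection trades [C], which has
    eigenvalue 1, for the Schur matrix [Cbar C w]. *)
Lemma Ibar_v_mul C w : C *m w = w -> \sum_j w j 0 = m%:R ->
  (forall j, \sum_i C i j = 1) -> Ibar_v w *m C = Cbar C w *m Ibar_v w.
Proof.
move=> Cw w1 C1.
have oC : (ones R m)^T *m C = (ones R m)^T.
  apply/matrixP => i j; rewrite !mxE -[RHS](C1 j); apply: eq_bigr => k _.
  by rewrite !mxE mul1r.
have Cbw : Cbar C w *m w = 0.
  rewrite /Cbar mulmxBl Cw -scalemxAl -mulmxA tr_ones_mul w1 mul_mx_scalar.
  by rewrite scalerA mulVf // scale1r subrr.
rewrite /Ibar_v mulmxBl mul1mx -scalemxAl -mulmxA oC.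
by rewrite mulmxBr mulmx1 -scalemxAr mulmxA Cbw mul0mx scaler0 subr0.
Qed.

Lemma Ibar_u_mul P w : w^T *m P = w^T -> \sum_j w j 0 = m%:R ->
  (forall i, \sum_j P i j = 1) -> Ibar_u w *m P = Rbar P w *m Ibar_u w.
Proof.
move=> wP w1 P1.
have Po : P *m ones R m = ones R m.
  apply/matrixP => i j; rewrite !mxE -[RHS](P1 i); apply: eq_bigr => k _.
  by rewrite !mxE mulr1.
have wo : w^T *m ones R m = m%:R%:M.
  by apply: trmx_inj; rewrite trmx_mul trmxK tr_ones_mul w1 tr_scalar_mx.
have Rbo : Rbar P w *m ones R m = 0.
  rewrite /Rbar mulmxBl Po -scalemxAl -mulmxA wo mul_mx_scalar.
  by rewrite scalerA mulVf // scale1r subrr.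
rewrite /Ibar_u mulmxBl mul1mx -scalemxAl -mulmxA wP.
by rewrite mulmxBr mulmx1 -scalemxAr mulmxA Rbo mul0mx scaler0 subr0.
Qed.

Lemma Ibar_v_apply w (z : 'cV[R]_m) :
  Ibar_v w *m z = z - (m%:R^-1 * \sum_j z j 0) *: w.
Proof.
by rewrite /Ibar_v mulmxBl mul1mx -scalemxAl -mulmxA tr_ones_mul mul_mx_scalar scalerA.
Qed.

Lemma Ibar_u_apply w (z : 'cV[R]_m) j :
  (Ibar_u w *m z) j 0 = z j 0 - dotv w z / m%:R.
Proof.
rewrite /Ibar_u mulmxBl mul1mx -scalemxAl -mulmxA [w^T *m z]mx11_scalar mul_mx_scalar.
rewrite -/(dotv w z); set s := dotv w z.
by rewrite !mxE mulr1 mulrC.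
Qed.

End Averaging.

(** Of the half that [P] and [X] lose, a quarter pays the cross terms and an eighth the [al ^+ 2]
    terms. What survives is [al * l / 2] on [Td] and [g3 / 4] on [Tx], hence the minimum. *)
Lemma descent_combine (Nr al l b1 b2 B1 B2 B3 px pf xx g1 g2 g3 sg
    Vd Vd' Vp Vp' Vf Vf' Vx Vx' Td P X Tx : R) :
  0 <= Td -> 0 <= P -> 0 <= X -> 0 <= Tx -> 0 <= Nr ->
  0 < al -> al <= 1 -> 0 < sg -> 0 <= b1 -> 0 <= b2 ->
  g1 = 4 * b1 -> g2 = 4 * (b2 + pf * g1) -> g3 = 4 * (px * g1 + xx * g2) ->
  0 < g1 -> 0 < g2 -> 0 < g3 ->
  sg = B1 + g2 * B2 + g3 * B3 ->
  al * (2 * Nr * sg) <= l -> al * (8 * sg) <= g1 -> al * (8 * sg) <= g2 ->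
  Vd' <= Vd - al * l * Td + al * b1 * P + al * b2 * X + al ^+ 2 * B1 * (P + X + Nr * Td) ->
  Vp' <= Vp - 2^-1 * P + pf * X + px * Tx ->
  Vf' <= Vf - 2^-1 * X + xx * Tx + al ^+ 2 * B2 * (P + X + Nr * Td) ->
  Vx' <= Vx - 2^-1 * Tx + al ^+ 2 * B3 * (P + X + Nr * Td) ->
  Vd' + g1 * Vp' + g2 * Vf' + g3 * Vx' <=
  Vd + g1 * Vp + g2 * Vf + g3 * Vx - Num.min (al * l / 2) (g3 / 4) * (Td + Tx).
Proof.
move=> Td0 P0 X0 Tx0 Nr0 al0 al1 sg0 b10 b20 e1 e2 e3 g10 g20 g30 es h0 h1 h2 hd hp hf hx.
have hp' := ler_wpM2l (ltW g10) hp.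
have hf' := ler_wpM2l (ltW g20) hf.
have hx' := ler_wpM2l (ltW g30) hx.
set c := Num.min _ _.
have c1 : c * Td <= al * l / 2 * Td by rewrite ler_wpM2r // ge_min lexx.
have c2 : c * Tx <= g3 / 4 * Tx by rewrite ler_wpM2r // ge_min lexx orbT.
(* Here [al <= 1] frees the weights [g1] and [g2] from any dependence on the step size. *)
have a1 : al * b1 * P <= b1 * P by rewrite ler_wpM2r // ler_piMl.
have a2 : al * b2 * X <= b2 * X by rewrite ler_wpM2r // ler_piMl.
have q2 : al ^+ 2 <= al by rewrite expr2 ler_piMl // ltW.
have s1 : al ^+ 2 * sg * P <= g1 / 8 * P.
  rewrite ler_wpM2r //; apply: (le_trans (ler_wpM2r (ltW sg0) q2)); lra.
have s2 : al ^+ 2 * sg * X <= g2 / 8 * X.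
  rewrite ler_wpM2r //; apply: (le_trans (ler_wpM2r (ltW sg0) q2)); lra.
have s3 : al ^+ 2 * sg * (Nr * Td) <= al * l / 2 * Td.
  rewrite mulrA ler_wpM2r //.
  have := ler_wpM2l (ltW al0) h0; rewrite expr2; lra.
have eZ : al ^+ 2 * B1 * (P + X + Nr * Td) + g2 * (al ^+ 2 * B2 * (P + X + Nr * Td))
   + g3 * (al ^+ 2 * B3 * (P + X + Nr * Td)) =
   al ^+ 2 * sg * P + al ^+ 2 * sg * X + al ^+ 2 * sg * (Nr * Td).
  by rewrite es; ring.
have gP : b1 * P = g1 / 4 * P by rewrite e1; field.
have gX : b2 * X + pf * g1 * X = g2 / 4 * X by rewrite e2; field.
have gx : px * g1 * Tx + xx * g2 * Tx = g3 / 4 * Tx by rewrite e3; field.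
have p1 : 0 <= g1 * P by rewrite mulr_ge0 // ltW.
have p2 : 0 <= g2 * X by rewrite mulr_ge0 // ltW.
move: hd hp' hf' hx' eZ.
set Z := P + X + Nr * Td => hd hp' hf' hx' eZ.
rewrite mulrDr; nra.
Qed.

End Generic.

(** * The estimation matrix acting on families indexed by pairs of agents *)

Section Estimation.
Variables (R : realType) (N : nat) (n : 'I_N -> nat) (E : rel (Agent n)).
Local Notation Ag := (Agent n).
Local Notation nsum := #|{: Ag}|.
Local Notation D := #|{: (Ag * Ag)%type}|.
Local Notation H := (Hmx R E).

Definition pairvec (F : Ag -> Ag -> R) : 'cV[R]_D :=
  \col_t F (enum_val t).1 (enum_val t).2.

Lemma pairvec_sqr F : vnorm (pairvec F) ^+ 2 = \sum_a \sum_b F a b ^+ 2.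
Proof.
rewrite vnorm_sqr (eq_bigr (fun t => F (enum_val t).1 (enum_val t).2 ^+ 2)).
  by rewrite (sum_enum_val (fun s : Ag * Ag => F s.1 s.2 ^+ 2)) pair_big.
by move=> t _; rewrite mxE.
Qed.

Lemma pairvecB F G : pairvec F - pairvec G = pairvec (fun a b => F a b - G a b).
Proof. by apply/colP => t; rewrite !mxE. Qed.

Lemma Hmx_pairvec F : H *m pairvec F = pairvec (fun a c =>
  (deg R E a + adj R E c a)^-1 *
    (\sum_(b | E b a) (F a c - F b c) + adj R E c a * F a c)).
Proof.
apply/colP => t; rewrite !mxE.
rewrite (eq_bigr (fun s => Hent R E (enum_val t) (enum_val s)
    * F (enum_val s).1 (enum_val s).2)); last by move=> s _; rewrite !mxE.
rewrite (sum_enum_val (fun s => Hent R E (enum_val t) s * F s.1 s.2)).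
case: (enum_val t) => a c /=.
rewrite -(pair_big xpredT xpredT (fun b d => Hent R E (a, c) (b, d) * F b d)) /=.
have inner b : \sum_d Hent R E (a, c) (b, d) * F b d =
    (deg R E a + adj R E c a)^-1 * (Lap R E a b * F b c + (a == b)%:R * adj R E c a * F b c).
  rewrite (bigD1 c) //= big1 => [|d dc].
    by rewrite /Hent /= xpair_eqE eqxx andbT addr0 mulr1 -[LHS]mulrA mulrDl.
  by rewrite /Hent /= xpair_eqE (eq_sym c) (negbTE dc) andbF mulr0 mul0r addr0 mulr0 mul0r.
rewrite (eq_bigr _ (fun b _ => inner b)) -mulr_sumr big_split /=; congr (_ * (_ + _)).
  (* A loop at [a] is allowed in [E] but excluded from [adj]; its summand [F a c - F a c] is zero,
     so the two sums agree. *)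
  rewrite [RHS]big_mkcond (bigD1 a) //= [RHS](bigD1 a) //= /Lap eqxx subrr.
  rewrite (_ : (if E a a then 0 else 0) = 0) ?if_same // add0r.
  rewrite /deg (bigD1 a) //= [adj R E a a]/adj eqxx andbF add0r mulr_suml -big_split.
  apply: eq_bigr => b ba /=; rewrite eq_sym (negbTE ba) /adj ba andbT.
  by case: (E b a); rewrite ?mul1r ?mulN1r ?oppr0 ?mul0r ?addr0.
rewrite (bigD1 a) //= big1 ?addr0 ?eqxx ?mul1r // => b ba.
by rewrite eq_sym (negbTE ba) !mul0r.
Qed.

End Estimation.

(** * Error recursions and Lyapunov inequalities along the algorithm *)

Section Algorithm.
Variables (R : realType) (N : nat) (n : 'I_N -> nat).
Hypothesis hn : forall i, (0 < n i)%N.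
Variables (E : rel (Agent n)).
Variables (f : forall i, 'I_(n i) -> 'rV[R]_#|{: Agent n}| -> R).
Variables (lij : forall i, 'I_(n i) -> R) (l : R).
Variables (Rw Cw : forall i, 'M[R]_(n i)) (u v : forall i, 'cV[R]_(n i)).
Variables (WR Wc : forall i, 'M[R]_(n i)) (WM : 'M[R]_#|{: (Agent n * Agent n)%type}|).
Variable alpha : R.
Variable x : nat -> forall i, 'I_(n i) -> R.
Variable xi : nat -> forall i, 'I_(n i) -> 'rV[R]_#|{: Agent n}|.
Variable psi : nat -> forall i, 'I_(n i) -> 'I_(n i) -> R.
Arguments f : clear implicits.
Arguments lij : clear implicits.
Arguments Rw : clear implicits.
Arguments Cw : clear implicits.
Arguments u : clear implicits.
Arguments v : clear implicits.
Arguments WR : clear implicits.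
Arguments Wc : clear implicits.
Arguments x : clear implicits.
Arguments xi : clear implicits.
Arguments psi : clear implicits.
Local Notation Ag := (Agent n).
Local Notation nsum := #|{: Ag}|.
Local Notation expd := (@Defs.expand R N n).
Local Notation H := (Hmx R E).
Local Notation M := (Mmx R E).
Local Notation sumL2 i := (\sum_(j < n i) lij i j ^+ 2).
Local Notation uv i := (dotv (u i) (v i)).

Let nR_neq0 i : (n i)%:R != 0 :> R. Proof. by rewrite pnatr_eq0 -lt0n. Qed.

Definition xvec k i : 'cV[R]_(n i) := \col_j x k i j.
Definition psivec k i (m : 'I_(n i)) : 'cV[R]_(n i) := \col_j psi k i j m.
Definition psisum k i : 'cV[R]_(n i) := \sum_m psivec k m.
Definition xmean k : 'rV[R]_N := \row_i (dotv (u i) (xvec k i) / (n i)%:R).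
Definition xagent k (a : Ag) : R := x k (tag a) (tagged a).
Definition xiagent k (a b : Ag) : R := xi k (tag a) (tagged a) 0 (pos b).

Definition err_psi k i m := Ibar_v (v i) *m psivec k m.
Definition err_x k i := Ibar_u (u i) *m xvec k i.
Definition err_xi k := pairvec (fun a b => xiagent k a b - xmean k 0 (tag b)).

Definition Epsi k i := \sum_m vnorm (@err_psi k i m) ^+ 2.
Definition Exi k i := \sum_j rnorm (xi k i j - expd (xmean k)) ^+ 2.
Definition Ex k := \sum_i vnorm (err_x k i) ^+ 2.

Definition dgrad k i (m : 'I_(n i)) : 'cV[R]_(n i) :=
  \col_j (partial (f i j) (pos (ag m)) (xi k.+1 i j)
         - partial (f i j) (pos (ag m)) (xi k i j)).

Hypothesis flip : forall i j, grad_lipschitz (f i j) (lij i j).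
Hypothesis fdiff : forall i j a, differentiable (f i j) a.
Hypothesis R1 : forall i (j : 'I_(n i)), \sum_(m < n i) Rw i j m = 1.
Hypothesis C1 : forall i (j : 'I_(n i)), \sum_(m < n i) Cw i m j = 1.
Hypothesis hu : forall i, (u i)^T *m Rw i = (u i)^T /\ \sum_(j < n i) u i j 0 = (n i)%:R.
Hypothesis hv : forall i, Cw i *m v i = v i /\ \sum_(j < n i) v i j 0 = (n i)%:R.
Hypothesis hWc : forall i, sym_pd (Wc i) /\
     (Cbar (Cw i) (v i))^T *m Wc i *m Cbar (Cw i) (v i) - Wc i = - 1%:M.
Hypothesis hWR : forall i, sym_pd (WR i) /\
     (Rbar (Rw i) (u i))^T *m WR i *m Rbar (Rw i) (u i) - WR i = - 1%:M.
Hypothesis hWM : sym_pd WM /\ M^T *m WM *m M - WM = - 1%:M.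
Hypothesis psi0 : forall i (j m : 'I_(n i)),
     psi 0%N i j m = partial (f i j) (pos (ag m)) (xi 0%N i j).
Hypothesis xS : forall k i (j : 'I_(n i)),
     x k.+1 i j = \sum_(m < n i) Rw i j m * x k i m
                  - alpha / (n i)%:R * \sum_(m < n i) psi k i j m.
Hypothesis xiS : forall k i (j : 'I_(n i)) p (q : 'I_(n p)),
     xi k.+1 i j 0 (pos (ag q)) =
       xi k i j 0 (pos (ag q))
       - (deg R E (ag j) + adj R E (ag q) (ag j))^-1 *
         (\sum_(b : Agent n | E b (ag j)) (xi k i j 0 (pos (ag q)) - xi k (tag b) (tagged b) 0 (pos (ag q)))
          + adj R E (ag q) (ag j) * (xi k i j 0 (pos (ag q)) - x k p q)).
Hypothesis psiS : forall k i (j m : 'I_(n i)),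
     psi k.+1 i j m = \sum_(p < n i) Cw i j p * psi k i p m
                       + partial (f i j) (pos (ag m)) (xi k.+1 i j)
                       - partial (f i j) (pos (ag m)) (xi k i j).

Lemma err_xi_sqr k : vnorm (err_xi k) ^+ 2 = \sum_i Exi k i.
Proof.
rewrite pairvec_sqr sum_agent; apply: eq_bigr => i _; apply: eq_bigr => j _.
rewrite rnorm_sqr -(sum_enum_val (fun b => (xiagent k (ag j) b - xmean k 0 (tag b)) ^+ 2)).
by apply: eq_bigr => s _; rewrite !mxE /xiagent /= /pos enum_valK.
Qed.

Lemma err_x_entry k i j : err_x k i j 0 = x k i j - xmean k 0 i.
Proof. by rewrite Ibar_u_apply ?mxE. Qed.

Lemma xagent_sub_sqr k : \sum_b (xagent k b - xmean k 0 (tag b)) ^+ 2 = Ex k.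
Proof.
rewrite sum_agent; apply: eq_bigr => i _; rewrite vnorm_sqr; apply: eq_bigr => j _.
by rewrite err_x_entry.
Qed.

(** One copy of the deviations per observing agent; this repetition produces the factor [nsum] in
    [beta_psix] and [beta_xix]. *)
Definition xdev k : 'cV[R]_#|{: (Ag * Ag)%type}| :=
  pairvec (fun _ b => xagent k b - xmean k 0 (tag b)).

Lemma xdev_sqr k : vnorm (xdev k) ^+ 2 = nsum%:R * Ex k.
Proof.
by rewrite pairvec_sqr xagent_sub_sqr sumr_const mulr_natl.
Qed.

(** The Laplacian part kills a vector that is the same for all observers, so the coupling to the
    true states can be put inside [H]: it acts on the estimates minus the states, that is
    [err_xi k - xdev k]. *)
Lemma xivec_step k :
  pairvec (xiagent k.+1) = pairvec (xiagent k) - H *m (err_xi k - xdev k).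
Proof.
rewrite /err_xi /xdev pairvecB Hmx_pairvec pairvecB; apply/colP => t; rewrite !mxE.
case: (enum_val t) => -[i j] [p q] /=; rewrite /xiagent /= -/(ag j) -/(ag q) xiS.
congr (_ - _ * (_ + _ * _)); last by rewrite /xagent /=; ring.
by apply: eq_bigr => b _; ring.
Qed.

Lemma xi_move_le k : \sum_i \sum_j rnorm (xi k.+1 i j - xi k i j) ^+ 2 <=
  opnorm H ^+ 2 * (2 * (\sum_i Exi k i) + 2 * (nsum%:R * Ex k)).
Proof.
have -> : \sum_i \sum_j rnorm (xi k.+1 i j - xi k i j) ^+ 2 =
    vnorm (H *m (err_xi k + - xdev k)) ^+ 2.
  have -> : H *m (err_xi k + - xdev k) =
     pairvec (xiagent k) - pairvec (xiagent k.+1) by rewrite xivec_step subKr.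
  rewrite pairvecB pairvec_sqr sum_agent; apply: eq_bigr => i _; apply: eq_bigr => j _.
  rewrite rnorm_sqr -(sum_enum_val (fun b => (xiagent k (ag j) b - xiagent k.+1 (ag j) b) ^+ 2)).
  by apply: eq_bigr => s _; rewrite !mxE /xiagent /= /pos enum_valK -sqrrN opprB.
apply: (le_trans (vnorm_mulmx_sqr_le _ _)); rewrite ler_wpM2l ?sqr_ge0 //.
apply: (le_trans (vnormD_sqr _ _)); rewrite mulrDr err_xi_sqr.
by rewrite -scaleN1r vnormZ normrN1 mul1r xdev_sqr.
Qed.

Lemma err_psi_step k i m : err_psi k.+1 m =
  Cbar (Cw i) (v i) *m err_psi k m + Ibar_v (v i) *m dgrad k m.
Proof.
rewrite /err_psi mulmxA -Ibar_v_mul //; [|by case: (hv i)|by case: (hv i)].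
rewrite -mulmxA -mulmxDr; congr (_ *m _); apply/colP => j; rewrite !mxE psiS -addrA.
by congr (_ + _); apply: eq_bigr => p _; rewrite mxE.
Qed.

Lemma dgrad_sqr_le k i : \sum_m vnorm (@dgrad k i m) ^+ 2 <=
  \sum_j lij i j ^+ 2 * rnorm (xi k.+1 i j - xi k i j) ^+ 2.
Proof.
rewrite (eq_bigr (fun m => \sum_j (partial (f i j) (pos (ag m)) (xi k.+1 i j)
         - partial (f i j) (pos (ag m)) (xi k i j)) ^+ 2)); last first.
  by move=> m _; rewrite vnorm_sqr; apply: eq_bigr => j _; rewrite mxE.
by rewrite exchange_big; apply: ler_sum => j _; exact: partial_lipschitz_sum.
Qed.

Definition Vpsi k := \sum_i \sum_m quad (Wc i) (@err_psi k i m).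

Lemma Vpsi_step k : Vpsi k.+1 <= Vpsi k - 2^-1 * (\sum_i Epsi k i)
   + beta_psixi E lij Cw v Wc * (\sum_i Exi k i) + beta_psix E lij Cw v Wc * Ex k.
Proof.
pose c i := 2 * opnorm ((Cbar (Cw i) (v i))^T *m Wc i *m Ibar_v (v i)) ^+ 2
       + opnorm ((Ibar_v (v i))^T *m Wc i *m Ibar_v (v i)).
have c0 i : 0 <= c i by rewrite addr_ge0 ?mulr_ge0 ?sqr_ge0 ?opnorm_ge0.
set B := bmax (fun i : 'I_N => bmax (fun j : 'I_(n i) => c i * lij i j ^+ 2)).
have cB i j : c i * lij i j ^+ 2 <= B.
  apply: le_trans (le_bigmax _ (fun i : 'I_N => bmax (fun j : 'I_(n i) => c i * lij i j ^+ 2)) i).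
  exact: (le_bigmax _ (fun j : 'I_(n i) => c i * lij i j ^+ 2)).
have B0 : 0 <= B by exact: bigmax_ge_id.
have s1 : Vpsi k.+1 <= Vpsi k - 2^-1 * (\sum_i Epsi k i)
    + B * \sum_i \sum_j rnorm (xi k.+1 i j - xi k i j) ^+ 2.
  rewrite /Vpsi !mulr_sumr -sumrB -big_split; apply: ler_sum => i _ /=.
  apply: (@le_trans _ _ (\sum_m (quad (Wc i) (@err_psi k i m)
      - 2^-1 * vnorm (@err_psi k i m) ^+ 2 + c i * vnorm (@dgrad k i m) ^+ 2))).
    apply: ler_sum => m _; rewrite err_psi_step.
    by case: (hWc i) => hW hL; exact: quad_step.
  rewrite big_split sumrB /= -mulr_sumr lerD2l -mulr_sumr.
  apply: (le_trans (ler_wpM2l (c0 i) (dgrad_sqr_le k i))).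
  rewrite !mulr_sumr; apply: ler_sum => j _; rewrite mulrA ler_wpM2r ?sqr_ge0 //.
apply: (le_trans s1); rewrite -[leRHS]addrA lerD2l.
apply: (le_trans (ler_wpM2l B0 (xi_move_le k))).
rewrite le_eqVlt; apply/orP; left; apply/eqP.
by rewrite /beta_psix /beta_psixi -/(c _) -/B; ring.
Qed.


(** The gradient-tracking invariant: column-stochastic mixing preserves the total, the increments
    telescope, and the initialization makes the totals agree at time 0. *)
Lemma psi_conserved k i (m : 'I_(n i)) :
  \sum_j psi k i j m = \sum_j partial (f i j) (pos (ag m)) (xi k i j).
Proof.
elim: k => [|k IH]; first by apply: eq_bigr => j _; rewrite psi0.
rewrite (eq_bigr _ (fun j _ => psiS k j m)) sumrB big_split /= exchange_big /=.
rewrite (eq_bigr (fun p => psi k i p m)) ?IH => [|p _].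
  by rewrite addrAC subrr add0r.
by rewrite -mulr_suml C1 mul1r.
Qed.

(** The pseudogradient component of coalition [i] with every agent's own estimate in place of a
    common point. *)
Definition gsum k i := \sum_j \sum_(m < n i) partial (f i j) (pos (ag m)) (xi k i j).

Lemma psisum_split k i :
  psisum k i = \sum_m @err_psi k i m + (gsum k i / (n i)%:R) *: v i.
Proof.
rewrite /gsum exchange_big mulr_suml scaler_suml -big_split; apply: eq_bigr => m _ /=.
rewrite /err_psi Ibar_v_apply -psi_conserved mulrC.
rewrite (eq_bigr (fun j => psi k i j m)) ?subrK // => j _; by rewrite mxE.
Qed.

Lemma xvec_step k i :
  xvec k.+1 i = Rw i *m xvec k i - (alpha / (n i)%:R) *: psisum k i.
Proof.
apply/colP => j; rewrite !mxE xS summxE; congr (_ - _ * _).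
  by apply: eq_bigr => m _; rewrite mxE.
by apply: eq_bigr => m _; rewrite mxE.
Qed.

Lemma xmean_step k i : xmean k.+1 0 i =
  xmean k 0 i - alpha / (n i)%:R ^+ 2 * dotv (u i) (psisum k i).
Proof.
rewrite [LHS]mxE [X in _ = X - _]mxE xvec_step /dotv mulmxBr mulmxA; case: (hu i) => -> _.
rewrite -scalemxAr mxE [X in _ + X]mxE [X in - X]mxE mulrBl; congr (_ - _).
by field.
Qed.

Lemma err_x_step k i : err_x k.+1 i =
  Rbar (Rw i) (u i) *m err_x k i + Ibar_u (u i) *m (- (alpha / (n i)%:R) *: psisum k i).
Proof.
case: (hu i) => h1 h2.
by rewrite /err_x mulmxA -Ibar_u_mul // -mulmxA -mulmxDr xvec_step scaleNr.
Qed.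

Variable y : 'rV[R]_N.
Hypothesis l_gt0 : 0 < l.
Hypothesis mono : forall a b : 'rV[R]_N,
   \sum_(k < N) (a - b) 0 k * (Qmap f a - Qmap f b) 0 k >= l * rnorm (a - b) ^+ 2.
Hypothesis Qy : Qmap f y = 0.
Hypothesis uv_gt0 : forall i, 0 < uv i.

Definition Ey k := rnorm (xmean k - y) ^+ 2.
Definition Etot k := \sum_i Epsi k i + \sum_i Exi k i + N%:R * Ey k.

Lemma Ey_ge0 k : 0 <= Ey k. Proof. exact: sqr_ge0. Qed.
Lemma Epsi_ge0 k i : 0 <= Epsi k i.
Proof. by apply: sumr_ge0 => m _; exact: sqr_ge0. Qed.
Lemma Exi_ge0 k i : 0 <= Exi k i.
Proof. by apply: sumr_ge0 => m _; exact: sqr_ge0. Qed.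
Lemma Ex_ge0 k : 0 <= Ex k.
Proof. by apply: sumr_ge0 => m _; exact: sqr_ge0. Qed.

Lemma bmax_ge0 (I : finType) (F : I -> R) : 0 <= bmax F.
Proof. exact: bigmax_ge_id. Qed.

Lemma bmax_ub (I : finType) (F : I -> R) i : F i <= bmax F.
Proof. exact: le_bigmax. Qed.

Lemma gsum_sub_sqr k i : (gsum k i - Qmap f (xmean k) 0 i) ^+ 2 <=
  (n i)%:R * sumL2 i * Exi k i.
Proof.
rewrite Qmap_sum // /gsum -sumrB; under eq_bigr do rewrite -sumrB.
exact: (pseudogradient_sum_lipschitz flip _ (fun=> _)).
Qed.

Lemma sum_err_psi_sqr k i :
  vnorm (\sum_m @err_psi k i m) ^+ 2 <= (n i)%:R * Epsi k i.
Proof. by have := vnorm_sum_sqr_le (@err_psi k i); rewrite card_ord. Qed.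

(** The three summands of [b0] match three parts: the tracking error, the mismatch between [gsum]
    and the pseudogradient at the mean, and the latter itself, Lipschitz in [xmean k - y] because
    [Qmap f y = 0]. *)
Lemma psisum_sqr_le k i :
  vnorm (psisum k i) ^+ 2 <= b0 lij v i * (Epsi k i + Exi k i + Ey k).
Proof.
set q := (n i)%:R^-1 * vnorm (v i) ^+ 2 * sumL2 i.
set r := bmax (fun k : 'I_N => (n k)%:R) * vnorm (v i) ^+ 2 * sumL2 i.
have -> : b0 lij v i = (n i)%:R + q + r by rewrite /b0 /q /r; ring.
have q0 : 0 <= q.
  apply: mulr_ge0; last exact: sum_sqr_ge0.
  by apply: mulr_ge0; rewrite ?invr_ge0 ?sqr_ge0.
have r0 : 0 <= r.
  by apply: mulr_ge0; [apply: mulr_ge0; [exact: bmax_ge0|exact: sqr_ge0]|exact: sum_sqr_ge0].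
have -> : psisum k i = \sum_m @err_psi k i m
   + ((gsum k i - Qmap f (xmean k) 0 i) / (n i)%:R) *: v i
   + (Qmap f (xmean k) 0 i / (n i)%:R) *: v i.
  by rewrite psisum_split -addrA -scalerDl -mulrDl subrK.
have w0 : 0 <= (n i)%:R ^- 2 * vnorm (v i) ^+ 2 by rewrite mulr_ge0 ?invr_ge0 ?sqr_ge0.
have nZ (c : R) : vnorm ((c / (n i)%:R) *: v i) ^+ 2 =
    c ^+ 2 * ((n i)%:R ^- 2 * vnorm (v i) ^+ 2).
  rewrite vnormZ exprMn real_normK ?num_real // exprMn exprVn; ring.
apply: vnormD_sqr_weighted; rewrite ?addr_ge0 ?Epsi_ge0 ?Exi_ge0 ?Ey_ge0 //.
  apply: vnormD_sqr_weighted; rewrite ?Epsi_ge0 ?Exi_ge0 //; first exact: sum_err_psi_sqr.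
  rewrite nZ; have -> : q * Exi k i = (n i)%:R * sumL2 i * Exi k i * ((n i)%:R ^- 2 * vnorm (v i) ^+ 2).
    by rewrite /q; field.
  by apply: ler_wpM2r (gsum_sub_sqr _ _).
rewrite nZ; have -> : r * Ey k = (n i)%:R ^+ 2 * bmax (fun k => (n k)%:R) * sumL2 i * Ey k
    * ((n i)%:R ^- 2 * vnorm (v i) ^+ 2) by rewrite /r; field.
apply: ler_wpM2r => //.
by have := Qmap_lipschitz fdiff flip (xmean k) y i; rewrite Qy subr0.
Qed.

(** Shared source of the terms in [b1], [b2], [b3]. [Ey k] is charged once per coalition, whence the
    [N] in [Etot] and in the first bound on [alpha]. *)
Lemma weighted_psisum_le k (c w : 'I_N -> R) : (forall i, 0 <= c i) ->
  (forall i, c i * b0 lij v i = w i) ->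
  \sum_i c i * vnorm (psisum k i) ^+ 2 <= bmax w * Etot k.
Proof.
move=> c0 cw; apply: (@le_trans _ _ (\sum_i bmax w * (Epsi k i + Exi k i + Ey k))).
  apply: ler_sum => i _; apply: (le_trans (ler_wpM2l (c0 i) (psisum_sqr_le k i))).
  by rewrite mulrA cw ler_wpM2r ?bmax_ub ?addr_ge0 ?Epsi_ge0 ?Exi_ge0 ?Ey_ge0.
rewrite -mulr_sumr !big_split /= sumr_const card_ord -[Ey k *+ _]mulr_natl.
by [].
Qed.

Definition Vx k := \sum_i quad (WR i) (err_x k i).

Lemma Vx_step k : Vx k.+1 <= Vx k - 2^-1 * Ex k
   + alpha ^+ 2 * bmax (b3 lij Rw u v WR) * Etot k.
Proof.
pose c i := ((n i)%:R ^+ 2)^-1 *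
  (2 * opnorm ((Rbar (Rw i) (u i))^T *m WR i *m Ibar_u (u i)) ^+ 2
   + opnorm ((Ibar_u (u i))^T *m WR i *m Ibar_u (u i))).
have c0 i : 0 <= c i.
  by rewrite mulr_ge0 ?invr_ge0 ?exprn_ge0 ?addr_ge0 ?mulr_ge0 ?sqr_ge0 ?opnorm_ge0.
have s : Vx k.+1 <= Vx k - 2^-1 * Ex k
    + alpha ^+ 2 * \sum_i c i * vnorm (psisum k i) ^+ 2.
  rewrite /Vx /Ex !mulr_sumr -sumrB -big_split; apply: ler_sum => i _ /=.
  rewrite err_x_step; case: (hWR i) => hW hL; apply: (le_trans (quad_step _ _ _ hW hL)).
  rewrite lerD2l vnormZ exprMn real_normK ?num_real // sqrrN exprMn exprVn.
  by rewrite le_eqVlt; apply/orP; left; apply/eqP; rewrite /c; ring.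
apply: (le_trans s); rewrite lerD2l -mulrA ler_wpM2l ?sqr_ge0 //.
exact: weighted_psisum_le.
Qed.

Definition mdev k : 'cV[R]_#|{: (Ag * Ag)%type}| :=
  pairvec (fun _ b => xmean k 0 (tag b) - xmean k.+1 0 (tag b)).

(** Two inputs: the estimates chase the states rather than their means ([xdev]), and the means drift
    ([mdev]). The factor [1%:M] fits the shape of [quad_step]. *)
Lemma err_xi_step k :
  err_xi k.+1 = M *m err_xi k + 1%:M *m (H *m xdev k + mdev k).
Proof.
have -> : err_xi k.+1 = pairvec (xiagent k.+1) - pairvec (fun _ b => xmean k.+1 0 (tag b)).
  by rewrite pairvecB.
rewrite xivec_step mul1mx /Mmx mulmxBl mul1mx mulmxBr /mdev -pairvecB.
have -> : err_xi k = pairvec (xiagent k) - pairvec (fun _ b => xmean k 0 (tag b)).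
  by rewrite pairvecB.
have alg (a b c p q : 'cV[R]_#|{: (Ag * Ag)%type}|) :
  a - (p - q) - c = a - b - p + (q + (b - c)) by apply/colP => t; rewrite !mxE; ring.
exact: alg.
Qed.

Lemma mdev_sqr_le k : vnorm (mdev k) ^+ 2 <= alpha ^+ 2 * \sum_i nsum%:R *
  opnorm (((n i)%:R ^+ 2)^-1 *: (ones R (n i) *m (u i)^T)) ^+ 2 * vnorm (psisum k i) ^+ 2.
Proof.
rewrite pairvec_sqr sumr_const -[leLHS]mulr_natl sum_agent !mulr_sumr.
apply: ler_sum => i _ /=.
have h := vnorm_mulmx_sqr_le (((n i)%:R ^+ 2)^-1 *: (ones R (n i) *m (u i)^T)) (psisum k i).
have e : vnorm ((((n i)%:R ^+ 2)^-1 *: (ones R (n i) *m (u i)^T)) *m psisum k i) ^+ 2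
   = \sum_(j < n i) (((n i)%:R ^+ 2)^-1 * dotv (u i) (psisum k i)) ^+ 2.
  rewrite vnorm_sqr -scalemxAl -mulmxA [(u i)^T *m _]mx11_scalar -/(dotv _ _) mul_mx_scalar.
  set d := dotv _ _; by apply: eq_bigr => j _; rewrite !mxE mulr1.
rewrite e in h.
have -> : nsum%:R * (\sum_(j < n i) (xmean k 0 i - xmean k.+1 0 i) ^+ 2) =
    alpha ^+ 2 * (nsum%:R * \sum_(j < n i) (((n i)%:R ^+ 2)^-1 * dotv (u i) (psisum k i)) ^+ 2).
  rewrite !mulr_sumr; apply: eq_bigr => j _; rewrite xmean_step; ring.
rewrite -mulrA; apply: ler_wpM2l; first exact: sqr_ge0.
by apply: ler_wpM2l h; exact: ler0n.
Qed.

Definition Vxi k := quad WM (err_xi k).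

Lemma Vxi_step k : Vxi k.+1 <= Vxi k - 2^-1 * (\sum_i Exi k i)
  + beta_xix E WM * Ex k + alpha ^+ 2 * bmax (b2 E lij u v WM) * Etot k.
Proof.
case: hWM => hW hL.
pose c := 4 * opnorm (M^T *m WM) ^+ 2 + 2 * opnorm WM.
have c0 : 0 <= c by rewrite addr_ge0 ?mulr_ge0 ?sqr_ge0 ?opnorm_ge0.
have c20 : 0 <= c / 2 by rewrite divr_ge0.
pose o i := opnorm (((n i)%:R ^+ 2)^-1 *: (ones R (n i) *m (u i)^T)) ^+ 2.
have s := quad_step 1%:M (err_xi k) (H *m xdev k + mdev k) hW hL.
rewrite -err_xi_step err_xi_sqr mulmx1 trmx1 mul1mx mulmx1 in s.
apply: (le_trans s); rewrite -[leRHS]addrA lerD2l.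
have -> : 2 * opnorm (M^T *m WM) ^+ 2 + opnorm WM = c / 2 by rewrite /c; field.
(* Splitting the two inputs doubles the bracket of [quad_step], which explains the coefficients 4
   and 2 in [beta_xix] and [b2]. *)
apply: (le_trans (ler_wpM2l c20 (vnormD_sqr _ _))).
have h1 := vnorm_mulmx_sqr_le H (xdev k); rewrite xdev_sqr in h1.
have h2 := mdev_sqr_le k.
have h3 : \sum_i c * (nsum%:R * o i) * vnorm (psisum k i) ^+ 2 <= bmax (b2 E lij u v WM) * Etot k.
  apply: weighted_psisum_le => i.
    by apply: mulr_ge0 => //; apply: mulr_ge0; [exact: ler0n|exact: sqr_ge0].
  by rewrite /b2 -/(o i) -/c; ring.
rewrite mulrA divfK // mulrDr; apply: lerD.
  apply: (le_trans (ler_wpM2l c0 h1)).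
  by rewrite le_eqVlt; apply/orP; left; apply/eqP; rewrite /beta_xix -/c; ring.
apply: (le_trans (ler_wpM2l c0 h2)).
rewrite -[leRHS]mulrA mulrCA ler_wpM2l ?sqr_ge0 //; apply: le_trans h3.
rewrite mulr_sumr le_eqVlt; apply/orP; left; apply/eqP; apply: eq_bigr => i _.
by rewrite /o !mulrA.
Qed.

(** The weights invert the coalition-dependent step lengths of the mean, so that the first-order
    terms add up to the unweighted pairing in [mono]. *)
Definition Vy k := \sum_i (n i)%:R ^+ 3 / uv i * (xmean k 0 i - y 0 i) ^+ 2.

Lemma err_psi_dot_sqr k i : dotv (u i) (\sum_m @err_psi k i m) ^+ 2 <=
  vnorm (u i) ^+ 2 * ((n i)%:R * Epsi k i).
Proof.
apply: (le_trans (dotv_sqr_le _ _)); rewrite ler_wpM2l ?sqr_ge0 //.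
exact: sum_err_psi_sqr.
Qed.

(* Strong monotonicity yields a decrease of [2 alpha l] times the error; Young's
   inequality on each of the two cross terms costs [alpha l / 2] of it. *)
Lemma Vy_step k : 0 <= alpha -> Vy k.+1 <= Vy k - alpha * l * Ey k
  + alpha * beta_xbpsi l u v * (\sum_i Epsi k i)
  + alpha * beta_xbxi l lij * (\sum_i Exi k i)
  + alpha ^+ 2 * bmax (b1 lij u v) * Etot k.
Proof.
move=> a0.
pose d i := xmean k 0 i - y 0 i.
pose p i := (n i)%:R / uv i * dotv (u i) (\sum_m @err_psi k i m).
pose q i := gsum k i - Qmap f (xmean k) 0 i.
pose w i := dotv (u i) (psisum k i).
(* The rescaled motion of the mean is the exact pseudogradient plus a tracking error [p] and an
   estimation error [q]. *)
have wE i : (n i)%:R / uv i * w i = p i + q i + Qmap f (xmean k) 0 i.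
  rewrite /w psisum_split dotvDr.
  have -> : dotv (u i) ((gsum k i / (n i)%:R) *: v i) = gsum k i / (n i)%:R * uv i.
    by rewrite /dotv -scalemxAr mxE.
  by rewrite /q /p; field; rewrite nR_neq0 gt_eqF.
have EyE : Ey k = \sum_i d i ^+ 2.
  by rewrite /Ey rnorm_sqr; apply: eq_bigr => i _; rewrite !mxE /d mxE.
have hmono : l * Ey k <= \sum_i d i * Qmap f (xmean k) 0 i.
  have := mono (xmean k) y; rewrite Qy subr0 => /le_trans; apply.
  by rewrite le_eqVlt; apply/orP; left; apply/eqP; apply: eq_bigr => i _; rewrite /d !mxE.
have step i : (n i)%:R ^+ 3 / uv i * (xmean k.+1 0 i - y 0 i) ^+ 2 =
    (n i)%:R ^+ 3 / uv i * d i ^+ 2 - 2 * alpha * (d i * (p i + q i + Qmap f (xmean k) 0 i))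
    + alpha ^+ 2 * ((n i)%:R * uv i)^-1 * w i ^+ 2.
  rewrite -wE xmean_step -/(w i) /d; field; rewrite nR_neq0 gt_eqF //.
have young (a b : R) : - (2 * (a * b)) <= l / 2 * a ^+ 2 + 2 / l * b ^+ 2.
  rewrite -subr_ge0 (_ : _ - _ = (l / 2) * (a + 2 / l * b) ^+ 2); last first.
    by field; rewrite gt_eqF.
  by rewrite mulr_ge0 ?sqr_ge0 // divr_ge0 // ltW.
have hp : \sum_i 2 / l * p i ^+ 2 <= beta_xbpsi l u v * \sum_i Epsi k i.
  rewrite mulr_sumr; apply: ler_sum => i _; rewrite /beta_xbpsi -[leRHS]mulrA.
  apply: ler_wpM2l; first by rewrite divr_ge0 // ltW.
  apply: le_trans (ler_wpM2r (Epsi_ge0 _ _) (bmax_ub _ i)).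
  rewrite /p exprMn; have e0 := err_psi_dot_sqr k i.
  have c0 : 0 <= ((n i)%:R / uv i) ^+ 2 by exact: sqr_ge0.
  apply: (le_trans (ler_wpM2l c0 e0)).
  by rewrite le_eqVlt; apply/orP; left; apply/eqP; field; rewrite gt_eqF.
have hq : \sum_i 2 / l * q i ^+ 2 <= beta_xbxi l lij * \sum_i Exi k i.
  rewrite mulr_sumr; apply: ler_sum => i _; rewrite /beta_xbxi -[leRHS]mulrA.
  apply: ler_wpM2l; first by rewrite divr_ge0 // ltW.
  apply: le_trans (ler_wpM2r (Exi_ge0 _ _) (bmax_ub _ i)).
  exact: gsum_sub_sqr.
have hw : \sum_i ((n i)%:R * uv i)^-1 * w i ^+ 2 <= bmax (b1 lij u v) * Etot k.
  have c0 i : 0 <= vnorm (u i) ^+ 2 / ((n i)%:R * uv i).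
    by rewrite divr_ge0 ?sqr_ge0 ?mulr_ge0 // ltW.
  apply: le_trans (weighted_psisum_le k c0 (fun i => erefl)).
  apply: ler_sum => i _; rewrite mulrC [leRHS]mulrAC ler_wpM2r //.
    by rewrite invr_ge0 mulr_ge0 // ltW.
  exact: dotv_sqr_le.
rewrite /Vy (eq_bigr _ (fun i _ => step i)).
have -> : \sum_i ((n i)%:R ^+ 3 / uv i * d i ^+ 2
    - 2 * alpha * (d i * (p i + q i + Qmap f (xmean k) 0 i))
    + alpha ^+ 2 * ((n i)%:R * uv i)^-1 * w i ^+ 2) =
  \sum_i (n i)%:R ^+ 3 / uv i * d i ^+ 2
  + alpha * \sum_i (- (2 * (d i * p i)) + - (2 * (d i * q i)))
  - 2 * alpha * (\sum_i d i * Qmap f (xmean k) 0 i)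
  + alpha ^+ 2 * \sum_i ((n i)%:R * uv i)^-1 * w i ^+ 2.
  rewrite !mulr_sumr -sumrN -!big_split; apply: eq_bigr => i _ /=; ring.
have hpq : \sum_i (- (2 * (d i * p i)) + - (2 * (d i * q i))) <=
    l * Ey k + beta_xbpsi l u v * (\sum_i Epsi k i) + beta_xbxi l lij * (\sum_i Exi k i).
  apply: (@le_trans _ _ (\sum_i (l * d i ^+ 2 + 2 / l * p i ^+ 2 + 2 / l * q i ^+ 2))).
    by apply: ler_sum => i _; have := young (d i) (p i); have := young (d i) (q i); lra.
  by rewrite !big_split /= -mulr_sumr -EyE lerD // lerD.
have := ler_wpM2l a0 hpq; have := ler_wpM2l a0 hmono.
have := ler_wpM2l (sqr_ge0 alpha) hw; lra.
Qed.


(** * Step size, positivity of the weights, and the limit *)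

Lemma tracking_descent : 0 < alpha ->
  alpha <= alpha_bound E l lij Rw Cw u v WR Wc WM ->
  (fun k => Ey k + Ex k) @ \oo --> 0.
Proof.
move=> a0; rewrite /alpha_bound.
set sg := sigma _ _ _ _ _ _ _ _ _ _; set g1 := gamma1 _ _ _; set g2 := gamma2 _ _ _ _ _ _ _.
rewrite !le_min => /andP[/andP[al ag1] /andP[ag2 a1]].
(* Division by zero yields 0, so for [N = 0] the bound would force [alpha <= 0]; the same convention
   gives [0 < sg] next. *)
have N0 : (0 < N)%N.
  by rewrite lt0n; apply/eqP => N0; move: al; rewrite N0 mulr0 mul0r invr0 mulr0 leNgt a0.
have sg0 : 0 < sg.
  have := lt_le_trans a0 al.
  by rewrite pmulr_rgt0 // invr_gt0 pmulr_rgt0 // mulr_gt0 // ltr0n.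
have h0 : alpha * (2 * N%:R * sg) <= l by rewrite -ler_pdivlMr // !mulr_gt0 // ltr0n.
have h1 : alpha * (8 * sg) <= g1 by rewrite -ler_pdivlMr // mulr_gt0.
have h2 : alpha * (8 * sg) <= g2 by rewrite -ler_pdivlMr // mulr_gt0.
(* A positive [alpha] below the bounds already makes [gamma1] and [gamma2] positive. *)
have g10 : 0 < g1 by apply: lt_le_trans h1; rewrite !mulr_gt0.
have g20 : 0 < g2 by apply: lt_le_trans h2; rewrite !mulr_gt0.
pose g3 := gamma3 E l lij Cw u v Wc WM.
have agent0 : Agent n by exists (Ordinal N0); exact: Ordinal (hn _).
have [hW hL] := hWM.
(* An agent exists, so the identity is nonzero. With [WM = 0], or with [H = 0] and hence [M = 1],
   the Lyapunov equation would read [0 = - 1%:M]; thus both norms in [beta_xix] are positive, which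
   gives [0 < g3]. *)
have one_neq0 : (1%:M : 'M[R]_#|{: (Ag * Ag)%type}|) != 0.
  apply/eqP => /matrixP/(_ (enum_rank (agent0, agent0)) (enum_rank (agent0, agent0))).
  by rewrite !mxE eqxx => /eqP; rewrite oner_eq0.
have WM0 : WM != 0.
  apply: contra_neq one_neq0 => W0.
  by apply/eqP; rewrite -oppr_eq0 -hL W0 mulmx0 mul0mx subr0.
have H0 : H != 0.
  apply: contra_neq one_neq0 => H0.
  by apply/eqP; rewrite -oppr_eq0 -hL /Mmx H0 subr0 trmx1 mul1mx mulmx1 subrr.
have bpx : 0 <= beta_psixi E lij Cw v Wc.
  by apply: mulr_ge0; [apply: mulr_ge0 => //; exact: bmax_ge0|exact: sqr_ge0].
have g30 : 0 < g3.
  rewrite pmulr_rgt0 //; apply: ltr_wpDl.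
    by apply: mulr_ge0 (ltW g10); apply: mulr_ge0.
  rewrite mulr_gt0 //; apply: mulr_gt0; last by rewrite exprn_gt0 // opnorm_gt0.
  apply: mulr_gt0; first by rewrite ltr0n; apply/card_gt0P; exists agent0.
  apply: ltr_wpDl; first by apply: mulr_ge0 => //; exact: sqr_ge0.
  by apply: mulr_gt0 => //; exact: opnorm_gt0.
pose V k := Vy k + g1 * Vpsi k + g2 * Vxi k + g3 * Vx k.
apply: (@descent_cvg0 _ V _ (Num.min (alpha * l / 2) (g3 / 4))).
- by rewrite lt_min !divr_gt0 // mulr_gt0.
- move=> k; rewrite !addr_ge0 //.
  + apply: sumr_ge0 => i _; rewrite mulr_ge0 ?sqr_ge0 // divr_ge0 ?exprn_ge0 //.
    exact: ltW.
  + rewrite mulr_ge0 ?(ltW g10) //; apply: sumr_ge0 => i _; apply: sumr_ge0 => m _.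
    by apply: quad_ge0; case: (hWc i).
  + by rewrite mulr_ge0 ?(ltW g20) // quad_ge0.
  + rewrite mulr_ge0 ?(ltW g30) //; apply: sumr_ge0 => i _.
    by apply: quad_ge0; case: (hWR i).
- by move=> k; rewrite addr_ge0 ?Ey_ge0 ?Ex_ge0.
move=> k; have a0' := ltW a0.
have dy := Vy_step k a0'; have dp := Vpsi_step k; have df := Vxi_step k; have dx := Vx_step k.
apply: (descent_combine (Nr := N%:R) (sg := sg) _ _ _ _ _ a0 a1 sg0 _ _
  erefl erefl erefl g10 g20 g30 _ h0 h1 h2 dy dp df dx) => //.
- exact: Ey_ge0.
- by apply: sumr_ge0 => i _; exact: Epsi_ge0.
- by apply: sumr_ge0 => i _; exact: Exi_ge0.
- exact: Ex_ge0.
- by apply: mulr_ge0; [rewrite divr_ge0 // ltW|exact: bmax_ge0].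
- by apply: mulr_ge0; [rewrite divr_ge0 // ltW|exact: bmax_ge0].
Qed.

Lemma xagent_cvg : 0 < alpha -> alpha <= alpha_bound E l lij Rw Cw u v WR Wc WM ->
  (fun k => \row_(s < nsum) xagent k (enum_val s)) @ \oo --> expd y.
Proof.
move=> a0 a1; have e0 := tracking_descent a0 a1.
have e20 : (fun k => 2 * (Ey k + Ex k)) @ \oo --> 0.
  by rewrite -[X in _ --> X](mulr0 2); apply: cvgM => //; exact: cvg_cst.
apply: (cvg_row_sqr e20) => k s; rewrite !mxE; set b := enum_val s.
have hx : (xagent k b - xmean k 0 (tag b)) ^+ 2 <= Ex k.
  rewrite -xagent_sub_sqr (bigD1 b) //= lerDl.
  by apply: sumr_ge0 => c _; exact: sqr_ge0.
have hy : (xmean k 0 (tag b) - y 0 (tag b)) ^+ 2 <= Ey k.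
  rewrite /Ey rnorm_sqr (bigD1 (tag b)) //= [in leRHS]mxE [X in _ <= (_ + X) ^+ 2 + _]mxE lerDl.
  by apply: sumr_ge0 => c _; exact: sqr_ge0.
have := sqr_ge0 ((xagent k b - xmean k 0 (tag b)) - (xmean k 0 (tag b) - y 0 (tag b))).
nra.
Qed.

End Algorithm.

(** * Positivity of the eigenvectors from the coalition graphs *)

Section Weights.
Variables (R : realType) (N : nat) (n : 'I_N -> nat) (E : rel (Agent n)).

(** All vertices of a path confined to coalition [i] carry the tag [i], so by induction the path can
    be reread inside ['I_(n i)]. *)
Lemma coalition_connect i (j m : 'I_(n i)) :
  connect (fun a b : Agent n => [&& E a b, tag a == i & tag b == i]) (ag j) (ag m) ->
  connect (fun p q : 'I_(n i) => E (ag p) (ag q)) j m.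
Proof.
move=> /connectP[s]; elim: s j => [|[i' m'] s IH] j /=.
  by move=> _ /ag_inj ->; exact: connect0.
move=> /andP[/and3P[Ejm _ /eqP ti] es] lst; subst i'.
exact: connect_trans (connect1 _) (IH m' es lst).
Qed.

Lemma dotv_gt0 m (a b : 'cV[R]_m) : (0 < m)%N ->
  (forall j, 0 < a j 0) -> (forall j, 0 < b j 0) -> 0 < dotv a b.
Proof.
move=> m0 a0 b0; rewrite dotvE (bigD1 (Ordinal m0)) //= ltr_pwDl ?mulr_gt0 //.
by apply: sumr_ge0 => j _; rewrite ltW ?mulr_gt0.
Qed.

(** Entry [P j m] is positive when [m] sends to [j], so positivity spreads along reversed edges,
    which connect just as well. *)
Lemma left_eigvec_gt0 i (P : 'M[R]_(n i)) (w : 'cV[R]_(n i)) : (0 < n i)%N ->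
  (forall j m : 'I_(n i), connect (fun p q : 'I_(n i) => E (ag p) (ag q)) j m) ->
  (forall j m : 'I_(n i), E (ag m) (ag j) || (m == j) -> 0 < P j m) ->
  (forall j m : 'I_(n i), ~~ (E (ag m) (ag j) || (m == j)) -> P j m = 0) ->
  (forall j, \sum_m P j m = 1) -> w^T *m P = w^T -> \sum_j w j 0 = (n i)%:R ->
  forall j, 0 < w j 0.
Proof.
move=> n0 conn Ppos Pzero P1 wP w1.
apply: (@stochastic_fixed_gt0 R _ P w (fun p q => E (ag q) (ag p))) => //.
- move=> j m; case: (boolP (E (ag m) (ag j) || (m == j))) => [/Ppos/ltW //|/Pzero ->//].
- by move=> j m e; apply: Ppos; rewrite e.
- by move=> j m; rewrite connect_rev; exact: conn.
- move=> j; have := congr1 (fun z : 'rV_(n i) => z 0 j) wP; rewrite !mxE => <-.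
  by apply: eq_bigr => k _; rewrite mxE.
- by rewrite w1 ltr0n.
Qed.

(** The transpose of [C] is row stochastic and follows the edges in their own direction. *)
Lemma right_eigvec_gt0 i (C : 'M[R]_(n i)) (w : 'cV[R]_(n i)) : (0 < n i)%N ->
  (forall j m : 'I_(n i), connect (fun p q : 'I_(n i) => E (ag p) (ag q)) j m) ->
  (forall j m : 'I_(n i), E (ag j) (ag m) || (m == j) -> 0 < C m j) ->
  (forall j m : 'I_(n i), ~~ (E (ag j) (ag m) || (m == j)) -> C m j = 0) ->
  (forall j, \sum_m C m j = 1) -> C *m w = w -> \sum_j w j 0 = (n i)%:R ->
  forall j, 0 < w j 0.
Proof.
move=> n0 conn Cpos Czero C1 Cw w1.
apply: (@stochastic_fixed_gt0 R _ C^T w (fun p q => E (ag p) (ag q))) => //.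
- move=> j m; rewrite mxE.
  by case: (boolP (E (ag j) (ag m) || (m == j))) => [/Cpos/ltW //|/Czero ->].
- by move=> j; rewrite -[RHS](C1 j); apply: eq_bigr => m _; rewrite mxE.
- by move=> j m e; rewrite mxE; apply: Cpos; rewrite e.
- move=> j; rewrite -[in RHS]Cw mxE.
  by apply: eq_bigr => k _; rewrite mxE mulrC.
- by rewrite w1 ltr0n.
Qed.

End Weights.

Theorem theorem1
  (R : realType) (N : nat) (n : 'I_N -> nat) (hn : forall i, (0 < n i)%N)
  (* directed graph: E pq ij  <->  (pq, ij) in the edge set *)
  (E : rel (Agent n))
  (* agent costs f_ij : R^{n_sum} -> R, Lipschitz constants l_ij, monotonicity constant l *)
  (f : forall i, 'I_(n i) -> 'rV[R]_#|{: Agent n}| -> R)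
  (lij : forall i, 'I_(n i) -> R) (l : R)
  (* weight matrices R_i = [r_ij^im], C_i = [c_ij^im] *)
  (Rw Cw : forall i, 'M[R]_(n i))
  (* auxiliary vectors and Lyapunov solutions *)
  (u v : forall i, 'cV[R]_(n i))
  (WR Wc : forall i, 'M[R]_(n i))
  (WM : 'M[R]_#|{: (Agent n * Agent n)%type}|)
  (alpha : R)
  (* trajectories of the algorithm *)
  (x : nat -> forall i, 'I_(n i) -> R)
  (xi : nat -> forall i, 'I_(n i) -> 'rV[R]_#|{: Agent n}|)
  (psi : nat -> forall i, 'I_(n i) -> 'I_(n i) -> R) :
  (* (A1) *)
  strongly_connected_A1 E ->
  (* (A2) *)
  (forall i j, convex_fun (f i j) /\ C2 (f i j) /\ grad_lipschitz (f i j) (lij i j)) ->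
  (* (A3) *)
  0 < l ->
  (forall a b : 'rV[R]_N,
     \sum_(k < N) (a - b) 0 k * (Qmap f a - Qmap f b) 0 k >= l * rnorm (a - b) ^+ 2) ->
  (* weights r_ij^im *)
  (forall i (j m : 'I_(n i)),
     (E (ag m) (ag j) || (m == j)) -> 0 < Rw i j m) ->
  (forall i (j m : 'I_(n i)),
     ~~ (E (ag m) (ag j) || (m == j)) -> Rw i j m = 0) ->
  (forall i (j : 'I_(n i)), \sum_(m < n i) Rw i j m = 1) ->
  (* weights c_im^ij *)
  (forall i (j m : 'I_(n i)),
     (E (ag j) (ag m) || (m == j)) -> 0 < Cw i m j) ->
  (forall i (j m : 'I_(n i)),
     ~~ (E (ag j) (ag m) || (m == j)) -> Cw i m j = 0) ->
  (forall i (j : 'I_(n i)), \sum_(m < n i) Cw i m j = 1) ->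
  (* u_i, v_i *)
  (forall i, (u i)^T *m Rw i = (u i)^T /\ \sum_(j < n i) u i j 0 = (n i)%:R) ->
  (forall i, Cw i *m v i = v i /\ \sum_(j < n i) v i j 0 = (n i)%:R) ->
  (* Lyapunov solutions *)
  (forall i, sym_pd (Wc i) /\
     (Cbar (Cw i) (v i))^T *m Wc i *m Cbar (Cw i) (v i) - Wc i = - 1%:M) ->
  (forall i, sym_pd (WR i) /\
     (Rbar (Rw i) (u i))^T *m WR i *m Rbar (Rw i) (u i) - WR i = - 1%:M) ->
  sym_pd WM /\ (Mmx R E)^T *m WM *m Mmx R E - WM = - 1%:M ->
  (* step size *)
  0 < alpha ->
  alpha <= alpha_bound E l lij Rw Cw u v WR Wc WM ->
  (* initialization (x(0), xi(0) arbitrary) *)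
  (forall i (j l' : 'I_(n i)),
     psi 0%N i j l' = partial (f i j) (pos (ag l')) (xi 0%N i j)) ->
  (* updates *)
  (forall k i (j : 'I_(n i)),
     x k.+1 i j = \sum_(m < n i) Rw i j m * x k i m
                  - alpha / (n i)%:R * \sum_(m < n i) psi k i j m) ->
  (forall k i (j : 'I_(n i)) p (q : 'I_(n p)),
     xi k.+1 i j 0 (pos (ag q)) =
       xi k i j 0 (pos (ag q))
       - (deg R E (ag j) + adj R E (ag q) (ag j))^-1 *
         (\sum_(b : Agent n | E b (ag j)) (xi k i j 0 (pos (ag q)) - xi k (tag b) (tagged b) 0 (pos (ag q)))
          + adj R E (ag q) (ag j) * (xi k i j 0 (pos (ag q)) - x k p q))) ->
  (forall k i (j l' : 'I_(n i)),
     psi k.+1 i j l' = \sum_(m < n i) Cw i j m * psi k i m l'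
                       + partial (f i j) (pos (ag l')) (xi k.+1 i j)
                       - partial (f i j) (pos (ag l')) (xi k i j)) ->
  (* conclusion: x(k) -> x*, the Nash equilibrium *)
  exists xstar : 'rV[R]_#|{: Agent n}|,
    is_NE f xstar /\
    (fun k => \row_(s < #|{: Agent n}|) x k (tag (enum_val s)) (tagged (enum_val s)))
      @ \oo --> xstar.
Proof.
move=> [_ conn] fA2 l0 mono Rpos Rzero R1 Cpos Czero C1 hu hv hWc hWR hWM a0 a1 psi0 xS xiS psiS.
have fdiff i j a : differentiable (f i j) a by case: (fA2 i j) => _ [[]].
have fconv i j : convex_fun (f i j) by case: (fA2 i j).
have flip i j : grad_lipschitz (f i j) (lij i j) by case: (fA2 i j) => _ [].
have [y [Qy NEy]] := exists_NE fdiff fconv flip l0 mono.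
exists (Defs.expand n y); split=> //.
have connE i (j m : 'I_(n i)) : connect (fun p q : 'I_(n i) => E (ag p) (ag q)) j m.
  exact: coalition_connect.
have uv_gt0 i : 0 < dotv (u i) (v i).
  have [u1 u2] := hu i; have [v1 v2] := hv i.
  apply: dotv_gt0 => //.
    exact: left_eigvec_gt0 (hn i) (@connE i) (Rpos i) (Rzero i) (R1 i) u1 u2.
  exact: right_eigvec_gt0 (hn i) (@connE i) (Cpos i) (Czero i) (C1 i) v1 v2.
exact: (xagent_cvg hn flip fdiff R1 C1 hu hv hWc hWR hWM psi0 xS xiS psiS l0 mono Qy uv_gt0 a0 a1).
Qed.
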